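(* Let $H$ be a separable Hilbert space and fix $n>0$. Let $(X_1,\dots,X_n)$ be $H$-valued and $(\epsilon_1,\dots,\epsilon_n)$ real-valued random variables, and $(\mathcal{F}_t)_{t\geq 0}$ a filtration such that for all $t$: $X_t$ is $\mathcal{F}_{t-1}$-measurable, $\epsilon_t$ is $\mathcal{F}_t$-measurable, and $\mathbb{E}[\epsilon_t\mid\mathcal{F}_{t-1}]=0$. Suppose that there exist a constant $B$ and $\mathcal{F}_{i-1}$-measurable $\sigma_i$ with $\mathbb{E}[|\epsilon_i|^m\mid\mathcal{F}_{i-1}]\le \frac12 m!\,B^{m-2}\sigma_i^2$ for all $m\ge 2$ and all $i$. Fix $\rho>0$ and set $V_t=\sum_{i\leq t}X_iX_i^T$, $M_t=\sum_{i\le t}X_i\epsilon_i$, $G_t=(\rho I+V_t)^{-1/2}X_t$. If $\sum_{i\le n}\sigma_i^2\|G_i\|^2\le C_n^2$ almost surely for a deterministic $C_n\ge0$, then for $\delta\in(0,1)$, with probability at least $1-\delta$, $$\sup_{t\le n}\|(\rho I+V_t)^{-1/2}M_t\|\le B\log(2/\delta)+C_n\sqrt{2\log(2/\delta)}.$$ Equivalently, for all $r\ge0$, $$\mathbb{P}\Big(\sup_{t\le n}\|(\rho I+V_t)^{-1/2}M_t\|\ge r\Big)\le 2\exp\Big(-\frac{r^2}{2(C_n^2+Br)}\Big).$$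
   Context: For $f,g\in H$, $fg^T$ denotes the operator $f\langle g,\cdot\rangle$ on $H$, and $I$ is the identity operator on $H$.
   Formalization: The constant B is assumed nonnegative (for B<0 the claim fails, e.g. all X_i, ε_i, σ_i zero, B=-1, C_n=0); when C_n=B=0 the undefined quotient in the tail bound is read as 0. *)

(* Defs.v *)
From HB Require Import structures.
From mathcomp Require Import all_boot all_order all_algebra.
From mathcomp Require Import all_classical all_reals all_analysis.
From mathcomp Require Import measurable_realfun.
Set Implicit Arguments. Unset Strict Implicit. Unset Printing Implicit Defensive.
Import Order.TTheory GRing.Theory Num.Theory.
Import numFieldNormedType.Exports.
Local Open Scope classical_set_scope.
Local Open Scope ring_scope.

Definition is_inner_product (R : realType) (H : normedModType R)
    (ip : H -> H -> R) : Prop :=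
  [/\ (forall x y, ip x y = ip y x),
      (forall (a : R) x y z, ip (a *: x + y) z = a * ip x z + ip y z) &
      (forall x, ip x x = `|x| ^+ 2)].

Definition separable_space (R : realType) (H : normedModType R) : Prop :=
  exists D : set H, countable D /\ closure D = setT.

(* f g^T := f <g, .> ; V = sum_{1<=i<=t} X_i X_i^T *)
Definition Vop (R : realType) (H : normedModType R) (ip : H -> H -> R)
    (X : nat -> H) (t : nat) (v : H) : H :=
  \sum_(1 <= i < t.+1) (ip (X i) v) *: X i.

Definition shiftV (R : realType) (H : normedModType R) (ip : H -> H -> R)
    (rho : R) (X : nat -> H) (t : nat) (v : H) : H :=
  rho *: v + Vop ip X t v.

Definition is_inv_sqrt (R : realType) (H : normedModType R) (ip : H -> H -> R)
    (T S : H -> H) : Prop :=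
  [/\ (forall (a : R) x y, S (a *: x + y) = a *: S x + S y),
      (forall x y, ip (S x) y = ip x (S y)),
      (forall x, 0 <= ip (S x) x),
      (forall x, S (S (T x)) = x) &
      (forall x, T (S (S x)) = x)].

(* T^{-1/2} (the identity as junk value if it does not exist) *)
Definition inv_sqrt (R : realType) (H : normedModType R) (ip : H -> H -> R)
    (T : H -> H) : H -> H :=
  match pselect (exists S, is_inv_sqrt ip T S) with
  | left e => proj1_sig (cid e)
  | right _ => id
  end.

Definition sub_sigma d (Omega : measurableType d) (G : set (set Omega)) : Prop :=
  sigma_algebra setT G /\ G `<=` measurable.

Definition filtration d (Omega : measurableType d) (F : nat -> set (set Omega))
  : Prop :=
  (forall t, sub_sigma (F t)) /\ (forall s t, (s <= t)%N -> F s `<=` F t).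

Definition measurable_wrt d (Omega : measurableType d) d' (T : measurableType d')
    (G : set (set Omega)) (f : Omega -> T) : Prop :=
  forall B : set T, measurable B -> G (f @^-1` B).

Definition Hmeasurable_wrt d (Omega : measurableType d) (R : realType)
    (H : normedModType R) (G : set (set Omega)) (f : Omega -> H) : Prop :=
  forall U : set H, open U -> G (f @^-1` U).

Definition is_cond_exp d (Omega : measurableType d) (R : realType)
    (P : probability Omega R) (G : set (set Omega)) (Xv Y : Omega -> \bar R)
  : Prop :=
  measurable_wrt G Y /\
  forall A, G A -> (\int[P]_(w in A) Xv w = \int[P]_(w in A) Y w)%E.

Definition Mt (R : realType) (H : normedModType R) (X : nat -> H)
    (eps : nat -> R) (t : nat) : H :=
  \sum_(1 <= i < t.+1) eps i *: X i.

Definition sup_self_norm (R : realType) (H : normedModType R) (ip : H -> H -> R)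
    (rho : R) (X : nat -> H) (eps : nat -> R) (n : nat) : R :=
  \big[Num.max/0]_(t < n.+1)
     `| inv_sqrt ip (shiftV ip rho X t) (Mt X eps t) |.

Definition Gt (R : realType) (H : normedModType R) (ip : H -> H -> R)
    (rho : R) (X : nat -> H) (t : nat) : H :=
  inv_sqrt ip (shiftV ip rho X t) (X t).

(* Main.v *)
Require Import Defs.
From HB Require Import structures.
From mathcomp Require Import all_boot all_order all_algebra.
From mathcomp Require Import spectral complex ring lra.
From mathcomp Require Import all_classical all_reals all_analysis.
From mathcomp Require Import measurable_realfun.
Import Order.TTheory GRing.Theory Num.Theory.
Import numFieldNormedType.Exports.
Set Implicit Arguments. Unset Strict Implicit. Unset Printing Implicit Defensive.
Local Open Scope classical_set_scope.
Local Open Scope ring_scope.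

(** Write [T_t = rho I + V_t] and [Z_t = |T_t^(-1/2) M_t|].  Since [T_t] is
    [F_(t-1)]-measurable and dominates [T_(t-1)], the vector
    [T_t^(-1/2) M_t = u + eps_t G_t] is a centered perturbation of a predictable
    [u] with [|u| <= Z_(t-1)], and [|G_t| <= 1].  Pinelis' pointwise inequality
      [cosh |u + v| <= cosh |u| (exp |v| - |v|) + (sinh |u| / |u|) <u, v>]
    together with the moment condition makes
      [cosh (lam Z_t) exp (- k sum_(i <= t) sigma_i^2 |G_i|^2)],
    with [k = lam^2 / (2 (1 - lam B))], a supermartingale for [lam B < 1].
    Stopping it when [Z] reaches [r] gives
      [P (sup Z_t >= r) <= 2 exp (- lam r + k C^2)];
    the choices [lam = r / (C^2 + B r)] and [lam = s / (C + B s)] with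
    [s = sqrt (2 log (2 / delta))] yield the two bounds.

    Existence of [T_t^(-1/2)] comes from the spectral theorem applied to the Gram
    matrix of [X_1, ..., X_t]; measurability of [Z_t] and [|G_t|] from the
    Sherman-Morrison recursion for the numbers [<X_i, T_t^(-1) X_j>]. *)

(** * Symmetric matrices and interpolation *)

(** Over [R[i]] the matrix is Hermitian, so the spectral theorem gives a unitary diagonalization
    with real entries. The minimal polynomial of a diagonal matrix has its distinct entries as
    simple roots, and injectivity of [map_poly] brings the factorization back to [R]. *)
Lemma mxminpoly_symmetric_split (R : rcfType) n (G : 'M[R]_n.+1) : G^T = G ->
  exists2 s : seq R, uniq s & mxminpoly G = \prod_(x <- s) ('X - x%:P).
Proof.
move=> GT; pose toC := real_complex R : {rmorphism R -> R[i]}.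
pose GC := map_mx toC G.
have GCh : GC \is hermsymmx.
  apply/is_hermitianmxP; rewrite expr0 scale1r.
  apply/matrixP => i j; rewrite !mxE -[in LHS]GT mxE.
  by rewrite /toC /=; apply/esym/conjc_real.
have /orthomx_spectralP GCE := hermitian_normalmx GCh.
have dreal := hermitian_spectral_diag_real GCh.
set Q := spectralmx GC in GCE; set dg := spectral_diag GC in GCE dreal.
have Qu : Q \in unitmx by exact: spectral_unit.
pose s := undup [seq complex.Re (dg 0 i) | i <- enum 'I_n.+1].
exists s; first exact: undup_uniq.
apply: (@map_poly_inj _ _ toC).
rewrite -mxminpoly_map -/GC GCE.
have -> : invmx Q *m diag_mx dg *m Q = conjmx (invmx Q) (diag_mx dg).
  by rewrite conjVmx.
rewrite mxminpoly_uconj ?unitmx_inv// mxminpoly_diag rmorph_prod/=.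
have -> : undup [seq dg 0 i | i <- enum 'I_n.+1] = map toC s.
  rewrite /s -undup_map_inj; last exact: complexI.
  rewrite -[in RHS]map_comp; congr undup; apply: eq_map => i /=.
  by rewrite /toC /= RRe_real//; exact: (mxOverP dreal).
rewrite big_map; apply: eq_bigr => x _.
by rewrite rmorphB/= map_polyX map_polyC.
Qed.

(** Newton interpolation: the correction for a new node is a multiple of the polynomial [w] that
    vanishes at all previous ones. *)
Lemma poly_interpolation (F : fieldType) (s : seq F) (f : F -> F) : uniq s ->
  exists p : {poly F}, {in s, forall x, p.[x] = f x}.
Proof.
elim: s => [_|x s IH /= /andP[xs /IH[p pE]]]; first by exists 0.
pose w := \prod_(y <- s) ('X - y%:P).
have w0 : w.[x] != 0 by rewrite -rootE root_prod_XsubC.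
exists (p + ((f x - p.[x]) / w.[x]) *: w) => y; rewrite inE => /predU1P[->|ys].
  by rewrite !hornerE divfK// addrC subrK.
have /eqP wy : root w y by rewrite root_prod_XsubC.
by rewrite !hornerE wy mulr0 addr0 pE.
Qed.

(** The roots of the minimal polynomial are simple and are eigenvalues, so it divides every
    polynomial vanishing on the spectrum. *)
Lemma horner_mx_symmetric (R : rcfType) n (G : 'M[R]_n.+1) (p : {poly R}) :
  G^T = G -> (forall x, eigenvalue G x -> p.[x] = 0) -> horner_mx G p = 0.
Proof.
move=> GT p0; have [s us sE] := mxminpoly_symmetric_split GT.
apply/mxminpoly_minP; rewrite sE; apply: uniq_roots_dvdp.
  apply/allP => x xs; apply/eqP/p0.
  by rewrite eigenvalue_root_min sE root_prod_XsubC.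
by rewrite uniq_rootsE.
Qed.

(* With [h := 2 b k + X k^2] and [h2 := 2 b^2 h + X h^2] one has
   [(b + X k)^4 (rho + X) = b^4 rho + X (b^4 + (rho + X) h2)]: the polynomial [k]
   interpolates [((rho + X)^(-1/4) - b) / X] at the eigenvalues of [G]. *)
Lemma fourth_root_gram (R : rcfType) n (G : 'M[R]_n.+1) (rho : R) :
  G^T = G -> (forall c : 'rV_n.+1, 0 <= (c *m G *m c^T) 0 0) -> 0 < rho ->
  exists (b : R) (k : {poly R}), b ^+ 4 * rho = 1 /\
    let h := (2 * b) *: k + 'X * k ^+ 2 in
    let h2 := (2 * b ^+ 2) *: h + 'X * h ^+ 2 in
    horner_mx G ((b ^+ 4)%:P + (rho%:P + 'X) * h2) = 0.
Proof.
move=> GT psd rho0.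
have sqrt4 (x : R) : 0 <= x -> Num.sqrt (Num.sqrt x) ^+ 4 = x.
  by move=> x0; rewrite (exprM _ 2 2) !sqr_sqrtr// sqrtr_ge0.
pose b := Num.sqrt (Num.sqrt rho^-1).
(* At [0] the value is the derivative of [(rho + x)^(-1/4)], the limit of the quotient in the other
   branch. *)
pose kf x := if x == 0 then - b / (4 * rho) else
   (Num.sqrt (Num.sqrt (rho + x)^-1) - b) / x.
have b4 : b ^+ 4 * rho = 1 by rewrite sqrt4 ?invr_ge0 ?ltW// mulVf// gt_eqF.
have [s us sE] := mxminpoly_symmetric_split GT.
have [k kE] := poly_interpolation kf us.
exists b, k; split => //=; apply: horner_mx_symmetric => // x ex.
have xs : x \in s by move: ex; rewrite eigenvalue_root_min sE root_prod_XsubC.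
(* Testing [psd] on an eigenvector [v] gives [0 <= x |v|^2]. *)
have x0 : 0 <= x.
  have /eigenvalueP[v vE v0] := ex; have := psd v.
  rewrite vE -scalemxAl mxE.
  have vv : 0 < (v *m v^T) 0 0.
    rewrite mxE lt_neqAle eq_sym sumr_ge0 ?andbT; last first.
      by move=> i _; rewrite mxE -expr2 sqr_ge0.
    rewrite psumr_neq0; last by move=> i _; rewrite mxE -expr2 sqr_ge0.
    have /rV0Pn[i vi] := v0.
    by apply/hasP; exists i; rewrite ?mem_index_enum//= mxE -expr2 exprn_even_gt0.
  by rewrite pmulr_lge0.
rewrite !hornerE kE//= /kf.
have rho_neq0 : rho != 0 by rewrite gt_eqF.
case: eqVneq => [->|xn0].
  transitivity ((b ^+ 4) * (1 - 1 * 1)); last by rewrite mulr1 subrr mulr0.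
  by field.
set r := Num.sqrt _; have r4 : r ^+ 4 * (rho + x) = 1.
  by rewrite sqrt4 ?invr_ge0 ?addr_ge0 ?(ltW rho0)// mulVf// gt_eqF// ltr_wpDr.
(* After multiplication by [x] the expression is [(b + x k)^4 (rho + x) - b^4 rho], and
   [b + x k = r]. *)
apply: (mulfI xn0); rewrite mulr0.
transitivity (r ^+ 4 * (rho + x) - b ^+ 4 * rho); last by rewrite r4 b4 subrr.
by field.
Qed.

(** * Inverse square roots of finite-rank perturbations of a multiple of the identity *)

Section InnerProduct.
Variables (R : realType) (H : normedModType R) (ip : H -> H -> R).
Hypothesis ipP : is_inner_product ip.

Lemma ipC x y : ip x y = ip y x. Proof. by case: ipP. Qed.

Lemma ipxx x : ip x x = `|x| ^+ 2. Proof. by case: ipP. Qed.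

Lemma ip_linl a x y z : ip (a *: x + y) z = a * ip x z + ip y z.
Proof. by case: ipP. Qed.

Lemma ipDl x y z : ip (x + y) z = ip x z + ip y z.
Proof. by rewrite -[x in LHS]scale1r ip_linl mul1r. Qed.

Lemma ip0l z : ip 0 z = 0.
Proof. by apply: (addrI (ip 0 z)); rewrite -ipDl !addr0. Qed.

Lemma ipZl a x z : ip (a *: x) z = a * ip x z.
Proof. by rewrite -[_ *: x]addr0 ip_linl ip0l addr0. Qed.

Lemma ipDr x y z : ip z (x + y) = ip z x + ip z y.
Proof. by rewrite !(ipC z) ipDl. Qed.

Lemma ipZr a x z : ip z (a *: x) = a * ip z x.
Proof. by rewrite !(ipC z) ipZl. Qed.

Lemma ip0r z : ip z 0 = 0. Proof. by rewrite ipC ip0l. Qed.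

Lemma ipxx_ge0 x : 0 <= ip x x. Proof. by rewrite ipxx sqr_ge0. Qed.

Lemma ip_suml (I : Type) (r : seq I) (P : pred I) (f : I -> H) z :
  ip (\sum_(i <- r | P i) f i) z = \sum_(i <- r | P i) ip (f i) z.
Proof. by apply: (big_morph (ip ^~ z)) => [x y|]; rewrite ?ipDl ?ip0l. Qed.

Lemma normD2 x y : `|x + y| ^+ 2 = `|x| ^+ 2 + 2 * ip x y + `|y| ^+ 2.
Proof. by rewrite -!ipxx ipDl !ipDr (ipC y x); ring. Qed.

(** The norm being given, Cauchy-Schwarz follows from the triangle inequality by expanding both
    squares. *)
Lemma ip_le x y : ip x y <= `|x| * `|y|.
Proof.
have : `|x + y| ^+ 2 <= (`|x| + `|y|) ^+ 2.
  by rewrite ler_pXn2r ?nnegrE ?ler_normD ?addr_ge0.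
by rewrite normD2; nra.
Qed.

Lemma normr_ip_le x y : `|ip x y| <= `|x| * `|y|.
Proof.
rewrite ler_norml ip_le andbT lerNl.
have := ip_le (- x) y; rewrite normrN -scaleN1r ipZl; lra.
Qed.

Section InverseSquareRoot.
Variables (n : nat) (Y : 'I_n.+1 -> H).

Let A (c : 'rV[R]_n.+1) : H := \sum_i c 0 i *: Y i.
Let Aadj (v : H) : 'rV[R]_n.+1 := \row_i ip (Y i) v.
Let G : 'M[R]_n.+1 := \matrix_(i, j) ip (Y i) (Y j).
(* Operators [b I + A K A^*] are closed under composition since [A^* A = G]. *)
Let op (b : R) (K : 'M[R]_n.+1) (v : H) : H := b *: v + A (Aadj v *m K).

Let AD c d : A (c + d) = A c + A d.
Proof. by rewrite -big_split; apply: eq_bigr => i _; rewrite mxE scalerDl. Qed.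

Let AZ a c : A (a *: c) = a *: A c.
Proof. by rewrite scaler_sumr; apply: eq_bigr => i _; rewrite mxE scalerA. Qed.

Let AadjD u v : Aadj (u + v) = Aadj u + Aadj v.
Proof. by apply/rowP => i; rewrite !mxE ipDr. Qed.

Let AadjZ a v : Aadj (a *: v) = a *: Aadj v.
Proof. by apply/rowP => i; rewrite !mxE ipZr. Qed.

Let AadjA c : Aadj (A c) = c *m G.
Proof.
apply/rowP => i; rewrite !mxE ipC ip_suml; apply: eq_bigr => j _.
by rewrite ipZl mxE.
Qed.

Let ipA c v : ip (A c) v = (c *m (Aadj v)^T) 0 0.
Proof. by rewrite ip_suml mxE; apply: eq_bigr => i _; rewrite !mxE ipZl. Qed.

Let opM b K c L v : op b K (op c L v) =
  op (b * c) (b *: L + c *: K + L *m G *m K) v.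
Proof.
rewrite /op AadjD AadjZ AadjA !mulmxDl !mulmxDr -!scalemxAl -!scalemxAr !AD !AZ.
by rewrite scalerDr !scalerA !mulmxA !addrA.
Qed.

Let op_lin b K a x y : op b K (a *: x + y) = a *: op b K x + op b K y.
Proof.
rewrite /op AadjD AadjZ mulmxDl -scalemxAl AD AZ !scalerDr !scalerA (mulrC b).
by rewrite addrACA.
Qed.

Let op_sym b K x y : K^T = K -> ip (op b K x) y = ip x (op b K y).
Proof.
move=> KT; rewrite /op ipDl ipDr ipZl ipZr; congr (_ + _).
rewrite ipA [RHS]ipC ipA.
transitivity (((Aadj y *m K *m (Aadj x)^T)^T) 0 0); last by rewrite mxE.
by rewrite !trmx_mul KT trmxK mulmxA.
Qed.

(** The witness is the square of [op b K], a symmetric fourth root of the inverse with [K] a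
    polynomial in [G]. Passing through a fourth root makes positivity immediate:
    [<op (op x), x> = |op x|^2]. *)
Lemma inv_sqrt_finite_rank (rho : R) : 0 < rho ->
  exists S, is_inv_sqrt ip (fun v => rho *: v + \sum_i ip (Y i) v *: Y i) S.
Proof.
move=> rho0.
have GT : G^T = G by apply/matrixP => i j; rewrite !mxE ipC.
have psd (c : 'rV_n.+1) : 0 <= (c *m G *m c^T) 0 0.
  have := ipxx_ge0 (A c); rewrite ipA AadjA trmx_mul GT mulmxA.
  by rewrite -mulmxA.
have [b [k [b4 /=]]] := fourth_root_gram GT psd rho0.
set h := _ + 'X * k ^+ 2; set h2 := _ + 'X * h ^+ 2 => k0.
pose K := horner_mx G k; pose Hm := horner_mx G h; pose H2 := horner_mx G h2.
have symp p : (horner_mx G p)^T = horner_mx G p.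
  elim/poly_ind: p => [|p c IH]; first by rewrite rmorph0 trmx0.
  rewrite rmorphD rmorphM /= horner_mx_X horner_mx_C linearD /= tr_scalar_mx.
  rewrite trmx_mul IH GT; congr (_ + _).
  by rewrite mulmxE -{1}(horner_mx_X G) -rmorphM mulrC rmorphM /= horner_mx_X.
have TE v : rho *: v + \sum_i ip (Y i) v *: Y i = op rho 1%:M v.
  by rewrite /op mulmx1; congr (_ + _); apply: eq_bigr => i _; rewrite mxE.
(* With [G] written as the value of ['X] at itself, identities between the matrices reduce to
   identities in the commutative ring [{poly R}]. *)
have GX : G = horner_mx G 'X by rewrite horner_mx_X.
have ssE v : op b K (op b K v) = op (b ^+ 2) Hm v.
  rewrite opM -expr2; congr op; rewrite /Hm /K /h [X in _ *m X *m _]GX !mulmxE.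
  rewrite -!linearZ -!rmorphM -!rmorphD/=; congr horner_mx; rewrite -!mul_polyC.
  by rewrite !polyCM; ring.
have SSE v : op (b ^+ 2) Hm (op (b ^+ 2) Hm v) = op (b ^+ 4) H2 v.
  rewrite opM -exprD; congr op; rewrite /H2 /h2 /Hm [X in _ *m X *m _]GX !mulmxE.
  rewrite -!linearZ -!rmorphM -!rmorphD/=; congr horner_mx; rewrite -!mul_polyC.
  by rewrite !polyCM; ring.
have op1 v : op 1 0 v = v.
  rewrite /op scale1r mulmx0 -[X in _ + X = _]/(A 0) -[0](scale0r 0) AZ scale0r.
  by rewrite addr0.
have one : (1%:M : 'M[R]_n.+1) = horner_mx G 1 by exact: (esym (rmorph1 (horner_mx G))).
exists (fun v => op b K (op b K v)); split => [a x y|x y|x|x|x].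
- by rewrite (op_lin b K a x y) (op_lin b K a (op b K x) (op b K y)).
- by rewrite (op_sym b (op b K x) y) ?symp// (op_sym b x) ?symp.
- by rewrite (op_sym b (op b K x) x) ?symp// ipxx_ge0.
(* The matrix of the composition is [b^4 + (rho + X) h2] evaluated at [G], which vanishes by
   [k0]. *)
- rewrite TE !ssE SSE opM b4 -[RHS]op1; congr op; rewrite -k0.
  rewrite /H2 [X in _ *m X *m _]GX one !mulmxE.
  rewrite -!linearZ -!rmorphM -!rmorphD/=; congr horner_mx; rewrite -!mul_polyC.
  by ring.
- rewrite TE !ssE SSE opM mulrC b4 -[RHS]op1; congr op; rewrite -k0.
  rewrite /H2 [X in _ *m X *m _]GX one !mulmxE.
  rewrite -!linearZ -!rmorphM -!rmorphD/=; congr horner_mx; rewrite -!mul_polyC.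
  by ring.
Qed.

End InverseSquareRoot.
End InnerProduct.

(** * Resolvents and the Sherman-Morrison recursion *)

Section Resolvent.
Variables (R : realType) (H : normedModType R) (ip : H -> H -> R).
Hypothesis ipP : is_inner_product ip.
Variables (rho : R) (X : nat -> H).
Hypothesis rho_gt0 : 0 < rho.

Local Notation T t := (shiftV ip rho X t).
Local Notation S t := (inv_sqrt ip (T t)).

(** This is [T_t^(-1)]; unlike the square root, it has an explicit rank-one recursion in [t]. *)
Definition resolvent t v := S t (S t v).

Lemma inv_sqrt_shiftVP t : is_inv_sqrt ip (T t) (S t).
Proof.
rewrite /inv_sqrt; case: pselect => [e|[]]; first by case: cid.
(* Index [0] carries the zero vector: ['I_t.+1] contains [0] while [Vop] sums from [1], and the
   family stays nonempty for [t = 0]. *)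
pose Y (i : 'I_t.+1) := if i == 0 :> nat then 0 else X i.
have [S0 S0P] := inv_sqrt_finite_rank ipP Y rho_gt0.
exists S0; rewrite (_ : T t = fun v => rho *: v + \sum_i ip (Y i) v *: Y i)//.
apply/funext => v; rewrite /shiftV /Vop; congr (_ + _).
rewrite big_ord_recl scaler0 add0r big_add1 big_mkord.
by apply: eq_bigr => i _.
Qed.

Lemma ip_inv_sqrt t x y : ip (S t x) (S t y) = ip x (resolvent t y).
Proof. by case: (inv_sqrt_shiftVP t) => _ /(_ x (S t y)). Qed.

Lemma sqr_norm_inv_sqrt t x : `|S t x| ^+ 2 = ip x (resolvent t x).
Proof. by rewrite -(ipxx ipP) ip_inv_sqrt. Qed.

Lemma inv_sqrtD t x y : S t (x + y) = S t x + S t y.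
Proof.
by case: (inv_sqrt_shiftVP t) => /(_ 1 x y) + _ _ _ _; rewrite !scale1r.
Qed.

Lemma inv_sqrtZ t a x : S t (a *: x) = a *: S t x.
Proof.
have S0 : S t 0 = 0 by apply: (addrI (S t 0)); rewrite -inv_sqrtD !addr0.
case: (inv_sqrt_shiftVP t) => /(_ a x 0) + _ _ _ _.
by rewrite S0 !addr0.
Qed.

Lemma resolvent_lin t x a y :
  resolvent t (x + a *: y) = resolvent t x + a *: resolvent t y.
Proof. by rewrite /resolvent (inv_sqrtD t x) inv_sqrtZ inv_sqrtD inv_sqrtZ. Qed.

Lemma resolventK t v : T t (resolvent t v) = v.
Proof. by case: (inv_sqrt_shiftVP t) => _ _ _ _; apply. Qed.

Lemma shiftVK t v : resolvent t (T t v) = v.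
Proof. by case: (inv_sqrt_shiftVP t) => _ _ _ + _; apply. Qed.

Lemma ip_resolventC t x y : ip x (resolvent t y) = ip y (resolvent t x).
Proof. by rewrite -!ip_inv_sqrt (ipC ipP). Qed.

Lemma resolvent_ge0 t x : 0 <= ip x (resolvent t x).
Proof. by rewrite -sqr_norm_inv_sqrt sqr_ge0. Qed.

Lemma ip_resolvent0 x y : ip x (resolvent 0 y) = ip x y / rho.
Proof.
have : T 0 (resolvent 0 y) = y by exact: resolventK.
rewrite /shiftV /Vop big_geq// addr0 => {2}<-.
by rewrite (ipZr ipP) mulrC mulKf// gt_eqF.
Qed.

(** With [z = T_(t+1)^(-1) y], applying [T_t^(-1)] to [y = T_t z + <X_(t+1), z> X_(t+1)] gives
    [key]; its case [u = X_(t+1)] determines [<X_(t+1), z>]. *)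
Lemma ip_sherman_morrison t x y (q := ip (X t.+1) (resolvent t (X t.+1))) :
  ip x (resolvent t.+1 y) = ip x (resolvent t y) -
    ip x (resolvent t (X t.+1)) * ip (X t.+1) (resolvent t y) / (1 + q).
Proof.
pose z := resolvent t.+1 y.
have TS v : T t.+1 v = T t v + ip (X t.+1) v *: X t.+1.
  by rewrite /shiftV /Vop big_nat_recr//= addrA.
have key u : ip u (resolvent t y) =
    ip u z + ip (X t.+1) z * ip u (resolvent t (X t.+1)).
  have -> : resolvent t y = z + ip (X t.+1) z *: resolvent t (X t.+1).
    rewrite -[y](resolventK t.+1) -/z TS.
    by rewrite (resolvent_lin t (T t z)) shiftVK.
  by rewrite (ipDr ipP) (ipZr ipP).
have q0 : 1 + q != 0 by rewrite gt_eqF// ltr_pwDl// resolvent_ge0.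
rewrite -/z key (key (X t.+1)) -/q; by field.
Qed.

(** For [y = x] the recursion subtracts a square divided by [1 + q > 0]. *)
Lemma norm_inv_sqrtS_le t x : `|S t.+1 x| <= `|S t x|.
Proof.
rewrite -(@ler_pXn2r _ 2) ?nnegrE// !sqr_norm_inv_sqrt ip_sherman_morrison.
rewrite lerBlDr lerDl divr_ge0//; last first.
  by rewrite addr_ge0// resolvent_ge0.
by rewrite (ip_resolventC t (X t.+1) x) -expr2 sqr_ge0.
Qed.

(** By the recursion the squared norm equals [q / (1 + q)]. *)
Lemma norm_Gt_le1 t : `|Gt ip rho X t.+1| <= 1.
Proof.
rewrite -(@ler_pXn2r _ 2) ?nnegrE// expr1n sqr_norm_inv_sqrt ip_sherman_morrison.
set q := ip _ (resolvent t _); have q0 : 0 <= q by exact: resolvent_ge0.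
have q1 : 0 < 1 + q by rewrite ltr_pwDl.
have -> : q - q * q / (1 + q) = q / (1 + q) by field; rewrite gt_eqF.
by rewrite ler_pdivrMr// mul1r lerDr.
Qed.

End Resolvent.

(** * Hyperbolic functions and Pinelis' inequality *)

Section HyperbolicCosine.
Variable R : realType.
Implicit Types p q w x y z : R.

Definition cosh x := (expR x + expR (- x)) / 2.
Definition sinh x := (expR x - expR (- x)) / 2.

Lemma cosh_gt0 x : 0 < cosh x.
Proof. by rewrite divr_gt0// addr_gt0// expR_gt0. Qed.

Lemma cosh_ge0 x : 0 <= cosh x. Proof. exact/ltW/cosh_gt0. Qed.

Lemma cosh_le x y : 0 <= x -> x <= y -> cosh x <= cosh y.
Proof.
move=> x0 xy; rewrite ler_pM2r// -subr_ge0.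
have y0 := le_trans x0 xy.
have -> : expR y + expR (- y) - (expR x + expR (- x)) =
    (expR y - expR x) * (1 - expR (- x) * expR (- y)).
  have Ex := expRxMexpNx_1 x; have Ey := expRxMexpNx_1 y.
  transitivity (expR y - expR x - (expR y * expR (- y)) * expR (- x) +
    (expR x * expR (- x)) * expR (- y)); last by ring.
  by rewrite Ex Ey; ring.
rewrite mulr_ge0 ?subr_ge0 ?ler_expR// -expRD expR_le1.
by rewrite -opprD oppr_le0 addr_ge0.
Qed.

Lemma coshN x : cosh (- x) = cosh x.
Proof. by rewrite /cosh opprK addrC. Qed.

Lemma cosh0 : cosh 0 = 1.
Proof. by rewrite /cosh oppr0 expR0 -[1 + 1]/(2%:R) divff. Qed.

Lemma sinh0 : sinh 0 = 0.
Proof. by rewrite /sinh oppr0 subrr mul0r. Qed.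

Lemma coshD x y : cosh (x + y) = cosh x * cosh y + sinh x * sinh y.
Proof. by rewrite /cosh /sinh opprD !expRD; field. Qed.

Lemma sinhN x : sinh (- x) = - sinh x.
Proof. by rewrite /sinh opprK; field. Qed.

Lemma expR_cosh_sinh x : expR x = cosh x + sinh x.
Proof. by rewrite /cosh /sinh; field. Qed.

Lemma norm_sinh_le_cosh x : `|sinh x| <= cosh x.
Proof.
have := expR_ge0 x; have := expR_ge0 (- x).
by rewrite ler_norml /cosh /sinh => ? ?; apply/andP; split; lra.
Qed.

Lemma cvg_series_exp_coeff x : series (exp_coeff x) @ \oo --> expR x.
Proof. exact: is_cvg_series_exp_coeff. Qed.

(** Induction on [k]: multiplying the hypothesis by the mean of [p] and [q] leaves the gap
    [(1 - w) w (p - q) (p^k - q^k)], whose last two factors have the same sign. *)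
Lemma convex_exprn w p q k : 0 <= w <= 1 -> 0 <= p -> 0 <= q ->
  ((1 - w) * p + w * q) ^+ k <= (1 - w) * p ^+ k + w * q ^+ k.
Proof.
move=> /andP[w0 w1] p0 q0; elim: k => [|k IH]; first by rewrite !expr0; lra.
have m0 : 0 <= (1 - w) * p + w * q by rewrite addr_ge0// mulr_ge0// subr_ge0.
rewrite exprS (le_trans (ler_wpM2l m0 IH))// !exprS -subr_ge0.
have -> : (1 - w) * (p * p ^+ k) + w * (q * q ^+ k) -
  ((1 - w) * p + w * q) * ((1 - w) * p ^+ k + w * q ^+ k) =
  (1 - w) * w * ((p - q) * (p ^+ k - q ^+ k)) by ring.
apply: mulr_ge0; first by rewrite mulr_ge0// subr_ge0.
have [pq|/ltW pq] := leP p q.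
  by rewrite mulr_le0 ?subr_le0 ?lerXn2r.
by rewrite mulr_ge0 ?subr_ge0 ?lerXn2r.
Qed.

(* Convexity of [x |-> cosh (sqrt x)], from the nonnegative coefficients of its
   power series. *)
Lemma cosh_sqrt_convex w p q z : 0 <= w <= 1 ->
  z ^+ 2 = (1 - w) * p ^+ 2 + w * q ^+ 2 ->
  cosh z <= (1 - w) * cosh p + w * cosh q.
Proof.
move=> w01 zE.
pose cs x k := series (fun i => (exp_coeff x i + exp_coeff (- x) i) / 2) k.
have cscvg x : cs x @ \oo --> cosh x.
  rewrite (_ : cs x = fun k =>
    (series (exp_coeff x) k + series (exp_coeff (- x)) k) / 2).
    by apply: cvgMr_tmp; apply: cvgD; exact: cvg_series_exp_coeff.
  by apply/funext => k; rewrite /cs /series/= -mulr_suml big_split.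
have lim : (1 - w) * cs p k + w * cs q k @[k --> \oo] -->
    (1 - w) * cosh p + w * cosh q.
  by apply: cvgD; apply: cvgMl_tmp; exact: cscvg.
apply: (ler_cvg_to (cscvg z) lim); apply: nearW => k /=.
rewrite /cs /series/= !mulr_sumr -big_split/=; apply: ler_sum => i _.
(* Odd terms cancel and even ones are monomials in [x^2], to which [convex_exprn] applies. *)
have evenE x : (exp_coeff x i + exp_coeff (- x) i) / 2 =
    if odd i then 0 else (x ^+ 2) ^+ (i./2) / i`!%:R.
  rewrite /exp_coeff/= exprNn -signr_odd -exprM mul2n.
  have := odd_double_half i; case: odd => /=.
    by rewrite expr1 mulN1r mulNr subrr mul0r.
  by rewrite add0n => ->; rewrite expr0 mul1r; field; rewrite pnatr_eq0 -lt0n fact_gt0.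
rewrite !evenE; case: odd; first by rewrite !mulr0 addr0.
rewrite !mulrA -mulrDl ler_wpM2r ?invr_ge0// zE convex_exprn ?sqr_ge0//.
Qed.

(** For [x >= 0] all terms of the power series are nonnegative, and the linear one is [x]. *)
Lemma sinh_ge x : 0 <= x -> x <= sinh x.
Proof.
move=> x0.
have lim : (series (exp_coeff x) k - series (exp_coeff (- x)) k) / 2
    @[k --> \oo] --> sinh x.
  by apply: cvgMr_tmp; apply: cvgB; exact: cvg_series_exp_coeff.
apply: (cvgr_to_ge lim); near=> k.
have k2 : (1 < k)%N by near: k; exact: nbhs_infty_gt.
rewrite ler_pdivlMr// /series/= -sumrB.
rewrite (bigD1_seq 1%N) ?mem_index_iota ?iota_uniq//=.
have -> : exp_coeff x 1 - exp_coeff (- x) 1 = x * 2.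
  by rewrite /exp_coeff/= !expr1 !divr1 opprK mulr2n mulrDr mulr1.
rewrite lerDl sumr_ge0// => i _.
rewrite /exp_coeff/= -mulrBl divr_ge0// exprNn -signr_odd subr_ge0.
by case: odd; rewrite ?mulN1r ?mul1r// (le_trans _ (exprn_ge0 _ x0))// oppr_le0 exprn_ge0.
Unshelve. all: by end_near.
Qed.

End HyperbolicCosine.

Section PinelisInequality.
Variables (R : realType) (H : normedModType R) (ip : H -> H -> R).
Hypothesis ipP : is_inner_product ip.

(* [cosh (sqrt (a^2 + b^2 + 2abc))] is convex in [c] and equals
   [cosh a cosh b + c sinh a sinh b] for [c = -1, 1]. *)
Lemma cosh_normD_le (u v : H) : cosh `|u + v| <=
  cosh `|u| * (expR `|v| - `|v|) + sinh `|u| / `|u| * ip u v.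
Proof.
(* The linear term vanishes here and the claim reduces to [|v| <= sinh |v|]. *)
have [->|u0] := eqVneq u 0.
  rewrite add0r normr0 cosh0 sinh0 !mul0r addr0 mul1r expR_cosh_sinh.
  by have := sinh_ge (normr_ge0 v); lra.
have [->|v0] := eqVneq v 0.
  by rewrite addr0 normr0 expR0 subr0 mulr1 (ip0r ipP) mulr0 addr0.
set a := `|u|; set b := `|v|.
have a0 : 0 < a by rewrite normr_gt0.
have b0 : 0 < b by rewrite normr_gt0.
pose c := ip u v / (a * b).
have ipE : ip u v = c * (a * b) by rewrite divfK// gt_eqF// mulr_gt0.
have /andP[cl cu] : -1 <= c <= 1.
  rewrite -ler_norml normrM normfV (gtr0_norm (mulr_gt0 a0 b0)).
  by rewrite ler_pdivrMr ?mulr_gt0// mul1r normr_ip_le.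
(* The weight [(1 + c) / 2] makes [|u + v|^2] a convex combination of [(a - b)^2] and
   [(a + b)^2]. *)
have w01 : 0 <= (1 + c) / 2 <= 1 by apply/andP; split; lra.
have zE : `|u + v| ^+ 2 =
    (1 - (1 + c) / 2) * (a - b) ^+ 2 + (1 + c) / 2 * (a + b) ^+ 2.
  by rewrite (normD2 ipP) -/a -/b ipE; field.
apply: le_trans (cosh_sqrt_convex w01 zE) _.
rewrite !coshD coshN sinhN ipE expR_cosh_sinh -subr_ge0.
(* The slack is a product of two nonnegative factors, the second because [|c| <= 1] and
   [|sinh a| <= cosh a]. *)
have -> : cosh a * (cosh b + sinh b - b) + sinh a / a * (c * (a * b)) -
  ((1 - (1 + c) / 2) * (cosh a * cosh b + sinh a * - sinh b) +
   (1 + c) / 2 * (cosh a * cosh b + sinh a * sinh b)) =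
  (sinh b - b) * (cosh a - c * sinh a) by field; rewrite gt_eqF.
rewrite mulr_ge0 ?subr_ge0 ?(sinh_ge (ltW b0))//.
rewrite (le_trans _ (norm_sinh_le_cosh a))// (le_trans (ler_norm _))// normrM.
by rewrite ler_piMl// ler_norml cl.
Qed.

End PinelisInequality.

(** * Weights measurable for a sub-sigma-algebra *)

Section SubSigmaAlgebra.
Context (d : measure_display) (Omega : measurableType d) (R : realType).
Variable (G : set (set Omega)).
Hypothesis subG : sub_sigma G.
Local Notation GT := (g_sigma_algebraType G).

(** A sigma-algebra generates only itself; viewing [G] as the measurable type [GT] makes the usual
    closure properties available for [G]-measurable maps. *)
Lemma measurable_subE (A : set Omega) : measurable (A : set GT) <-> G A.
Proof. by rewrite /measurable/= (sigma_algebra_id subG.1). Qed.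

Lemma measurable_wrtP d' (T : measurableType d') (f : Omega -> T) :
  measurable_wrt G f <-> measurable_fun [set: GT] (f : GT -> T).
Proof.
split=> [mf _ B mB|mf B mB].
  by rewrite setTI; apply/measurable_subE/mf.
by have := mf measurableT B mB; rewrite setTI => /measurable_subE.
Qed.

Lemma measurable_fun_sub d' (T : measurableType d') (f : Omega -> T) :
  measurable_fun [set: GT] (f : GT -> T) -> measurable_fun [set: Omega] f.
Proof.
move=> mf _ B mB; rewrite setTI; apply: subG.2.
by have /measurable_wrtP := mf; apply.
Qed.

Variable mu : {measure set Omega -> \bar R}.

Import HBNNSimple.

(** A simple weight reduces the integral to integrals of [f] over level sets, which belong to
    [G]. *)
Lemma integral_nnsfun_weight (h : {nnsfun GT >-> R}) (f : Omega -> R) :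
  measurable_fun [set: Omega] f -> (forall w, 0 <= f w) ->
  (\int[mu]_w ((h : GT -> R) w * f w)%:E =
   \sum_(y \in range (h : GT -> R))
     y%:E * \int[mu]_(w in (h : GT -> R) @^-1` [set y]) (f w)%:E)%E.
Proof.
move=> mf f0.
have mpre y : measurable ((h : GT -> R) @^-1` [set y] : set Omega).
  by apply: subG.2; apply/measurable_subE; exact: measurable_sfunP.
have term_ge0 (y : R) w : 0 <= y * \1_((h : GT -> R) @^-1` [set y]) w * f w.
  rewrite mulr_ge0// indicE; case: (boolP (w \in _)) => [|_]; rewrite ?mulr0//.
  by rewrite mulr1 inE/= => <-; exact: fun_ge0.
under eq_integral => w _ do rewrite (fimfunE h w) mulr_fsuml -fsumEFin//.
rewrite ge0_integral_fsum//=; last 2 first.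
- move=> y; apply/measurable_EFinP; apply: measurable_funM => //.
  apply: measurable_funM => //; exact: measurable_indic.
- by move=> y w _; rewrite lee_fin.
apply: eq_fsbigr => y /[!inE]-[w0 _ hw0].
have y0 : 0 <= y by rewrite -hw0; exact: fun_ge0.
rewrite [in RHS]integral_mkcond -ge0_integralZl//=.
- apply: eq_integral => w _; rewrite epatch_indic -mulrA EFinM; congr (_ * _)%E.
  by rewrite mulrC EFinM.
- by apply/measurable_restrict => //; apply/measurable_EFinP/measurable_funTS.
- by move=> w _; apply: erestrict_ge0 => z _; rewrite lee_fin.
Qed.

(** Stands in for pulling a [G]-measurable factor out of a conditional expectation: simple weights
    are handled by level sets, general ones by monotone convergence. *)
Lemma le_integral_weight (f g W : Omega -> R) :
  measurable_fun [set: Omega] f -> (forall w, 0 <= f w) ->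
  measurable_fun [set: Omega] g -> (forall w, 0 <= g w) ->
  (forall A, G A ->
    (\int[mu]_(w in A) (f w)%:E <= \int[mu]_(w in A) (g w)%:E)%E) ->
  measurable_fun [set: GT] (W : GT -> R) -> (forall w, 0 <= W w) ->
  (\int[mu]_w (W w * f w)%:E <= \int[mu]_w (W w * g w)%:E)%E.
Proof.
move=> mf f0 mg g0 fg mW W0.
have mEW : measurable_fun [set: GT] (EFin \o W : GT -> \bar R).
  exact/measurable_EFinP.
pose h := nnsfun_approx measurableT mEW.
have mh k : measurable_fun [set: Omega] (h k : Omega -> R).
  exact: (@measurable_fun_sub _ _ (h k)).
have cvgh (e : Omega -> R) : measurable_fun [set: Omega] e ->
    (forall w, 0 <= e w) ->
    (\int[mu]_w ((h k : Omega -> R) w * e w)%:E)%E @[k --> \oo] -->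
    (\int[mu]_w (W w * e w)%:E)%E.
  move=> me e0.
  rewrite (_ : (\int[mu]_w (W w * e w)%:E)%E =
    (\int[mu]_w limn (fun k => ((h k : Omega -> R) w * e w)%:E))%E); last first.
    apply: eq_integral => w _; apply/esym/cvg_lim => //.
    have hW : EFin \o h ^~ w @ \oo --> (W w)%:E.
      by apply: cvg_nnsfun_approx => //= t _; rewrite lee_fin.
    rewrite EFinM; under eq_fun do rewrite EFinM.
    by apply: cvgeZr.
  apply: cvg_monotone_convergence => //=.
  - by move=> k; apply/measurable_EFinP/measurable_funM.
  - by move=> k w _; rewrite lee_fin mulr_ge0//; exact: fun_ge0.
  - move=> w _ k l kl; rewrite lee_fin ler_wpM2r//.
    by have /lefP := @nd_nnsfun_approx _ _ _ _ measurableT _ mEW _ _ kl; apply.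
apply: (lee_cvg_to (cvgh f mf f0) (cvgh g mg g0)).
apply: nearW => k /=; rewrite !integral_nnsfun_weight//.
rewrite !fsbig_finite//=; apply: lee_sum => y _.
have [y0|y0] := leP 0 y.
  by rewrite lee_wpmul2l ?lee_fin// fg//; apply/measurable_subE; exact: measurable_sfunP.
by rewrite preimage_nnfun0// !integral_set0.
Qed.

End SubSigmaAlgebra.

(** * Measurability of real functions, norms and inner products *)

Section RealMeasurability.
Context (d : measure_display) (T : measurableType d) (R : realType).
Implicit Types f : T -> R.

(** The formula [f exp (- ln (f^2))] is also correct where [f] vanishes, because [0^-1 = 0]. *)
Lemma measurable_fun_inv f :
  measurable_fun [set: T] f -> measurable_fun [set: T] (fun x => (f x)^-1).
Proof.
move=> mf; rewrite (_ : (fun x => _) = fun x => f x * expR (- ln (f x ^+ 2))).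
  apply: measurable_funM => //; apply: measurableT_comp => //.
  apply: measurableT_comp => //; apply: measurableT_comp => //.
  exact: measurable_funX.
apply/funext => x; have [->|fx0] := eqVneq (f x) 0; first by rewrite invr0 mul0r.
rewrite expRN lnK ?posrE ?exprn_even_gt0// expr2 invfM mulrA divff// mul1r//.
Qed.

Lemma measurable_fun_sqrt f : measurable_fun [set: T] f ->
  (forall x, 0 <= f x) -> measurable_fun [set: T] (fun x => Num.sqrt (f x)).
Proof.
move=> mf f0; rewrite (_ : (fun x => _) = fun x => f x `^ 2^-1).
  exact: (measurableT_comp (measurable_powR 2^-1) mf).
by apply/funext => x; rewrite powR12_sqrt.
Qed.

Lemma measurable_fun_sum I (r : seq I) (P : pred I) (f : I -> T -> R) :
  (forall i, P i -> measurable_fun [set: T] (f i)) ->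
  measurable_fun [set: T] (fun x => \sum_(i <- r | P i) f i x).
Proof.
move=> mf; elim: r => [|i r IH]; first by under eq_fun do rewrite big_nil; exact: measurable_cst.
have [Pi|/negbTE Pi] := boolP (P i); under eq_fun do rewrite big_cons Pi; last by [].
by apply: measurable_funD => //; exact: mf.
Qed.

Lemma measurable_fun_sum_nat (m n : nat) (f : nat -> T -> R) :
  (forall i, (m <= i < n)%N -> measurable_fun [set: T] (f i)) ->
  measurable_fun [set: T] (fun x => \sum_(m <= i < n) f i x).
Proof.
by move=> mf; under eq_fun do rewrite big_nat; exact: measurable_fun_sum.
Qed.

Lemma measurable_fun_cosh f : measurable_fun [set: T] f ->
  measurable_fun [set: T] (fun x => cosh (f x)).
Proof.
move=> mf; apply: measurable_funM => //.
by apply: measurable_funD; apply: measurableT_comp => //; exact: measurableT_comp.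
Qed.

Lemma measurable_fun_sinh f : measurable_fun [set: T] f ->
  measurable_fun [set: T] (fun x => sinh (f x)).
Proof.
move=> mf; apply: measurable_funM => //.
by apply: measurable_funB; apply: measurableT_comp => //; exact: measurableT_comp.
Qed.

End RealMeasurability.

Section HilbertMeasurability.
Variables (R : realType) (H : normedModType R) (ip : H -> H -> R).
Hypothesis ipP : is_inner_product ip.
Hypothesis sepH : separable_space H.
Context (d : measure_display) (Omega : measurableType d).
Variable (G : set (set Omega)).
Hypothesis subG : sub_sigma G.
Local Notation GT := (g_sigma_algebraType G).

Lemma measurable_norm_shift (Y : Omega -> H) (a : H) :
  Hmeasurable_wrt G Y -> measurable_fun [set: GT] (fun w : GT => `|Y w + a|).
Proof.
move=> mY; apply: (measurability _ (RGenInftyO.measurableE R)).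
move=> _ [_ [x ->] <-]; rewrite setTI; apply/(measurable_subE subG).
apply: (mY [set h | `|h + a| < x]).
rewrite [X in open X](_ : _ = (fun h : H => `|h + a|) @^-1` `]-oo, x[%classic).
  apply: open_comp; last exact: interval_open.
  by move=> h _; apply: cvg_norm; apply: cvgD; [exact: cvg_id|exact: cvg_cst].
by apply/seteqP; split => h /=; rewrite in_itv.
Qed.

(* [`|x + y| < r] iff [`|x - a| + `|a + y| < r] for some [a] of a countable
   dense set. *)
Lemma measurable_normD (Y Z : Omega -> H) :
  Hmeasurable_wrt G Y -> Hmeasurable_wrt G Z ->
  measurable_fun [set: GT] (fun w : GT => `|Y w + Z w|).
Proof.
move=> mY mZ; have [D [cD dD]] := sepH.
have [s sP] : exists s : nat -> H, set_surj setT D s by exact/pcard_surjP.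
apply: (measurability _ (RGenInftyO.measurableE R)).
move=> _ [_ [x ->] <-]; rewrite setTI.
rewrite [X in measurable X](_ : _ =
  \bigcup_k [set w : GT | `|Y w + - s k| + `|Z w + s k| < x]).
  apply: bigcup_measurable => k _.
  rewrite [X in measurable X](_ : _ =
     setT `&` (fun w : GT => `|Y w + - s k| + `|Z w + s k|) @^-1` `]-oo, x[).
    by apply: measurable_funD => //; exact: measurable_norm_shift.
  by rewrite setTI; apply/seteqP; split => w /=; rewrite in_itv.
apply/seteqP; split => w /=; rewrite in_itv/=.
  (* Half the gap suffices: [|Y - a| < e] enters twice, once directly and once in
     [|Z + a| <= |Y + Z| + |Y - a|]. *)
  move=> wx; pose e := (x - `|Y w + Z w|) / 2.
  have e0 : 0 < e by rewrite divr_gt0// subr_gt0.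
  have : closure D (Y w) by rewrite dD.
  move=> /(_ (ball (Y w) e) (nbhsx_ballx _ _ e0))[a [Da]].
  rewrite -ball_normE/= => Ya; have [k _ ska] := sP _ Da.
  exists k => //=; rewrite ska.
  have : `|Z w + a| <= `|Y w + Z w| + `|Y w - a|.
    rewrite -[X in _ <= _ + X]normrN (le_trans _ (ler_normD _ _))//.
    by rewrite opprB [Y w + _]addrC addrACA subrr addr0.
  by move: Ya; rewrite /e; lra.
move=> [k _ /=]; apply: le_lt_trans.
rewrite (le_trans _ (ler_normD _ _))// [Z w + _]addrC addrA subrK//.
Qed.

(** Polarization reduces this to norms; the shifts by [0] bring [Y] and [Z] into the form of
    [measurable_norm_shift]. *)
Lemma measurable_ip (Y Z : Omega -> H) :
  Hmeasurable_wrt G Y -> Hmeasurable_wrt G Z ->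
  measurable_fun [set: GT] (fun w : GT => ip (Y w) (Z w)).
Proof.
move=> mY mZ.
rewrite (_ : (fun w : GT => _) = fun w : GT =>
  (`|Y w + Z w| ^+ 2 - `|Y w + 0| ^+ 2 - `|Z w + 0| ^+ 2) / 2).
  apply: measurable_funM => //; apply: measurable_funB.
    apply: measurable_funB; apply: measurable_funX; first exact: measurable_normD.
    exact: measurable_norm_shift.
  by apply: measurable_funX; exact: measurable_norm_shift.
by apply/funext => w; rewrite (normD2 ipP) !addr0; field.
Qed.

Section Process.
Variables (rho : R) (m : nat) (X : nat -> Omega -> H) (eps : nat -> Omega -> R).
Hypothesis rho_gt0 : 0 < rho.
Hypothesis mX : forall i, (1 <= i <= m)%N -> Hmeasurable_wrt G (X i).
Local Notation res t w := (resolvent ip rho (X ^~ w) t).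
Local Notation S t w := (inv_sqrt ip (shiftV ip rho (X ^~ w) t)).

(** Induction on [t] through Sherman-Morrison, for all [i] and [j] at once since the step brings in
    [X_(t+1)]. Working with these real numbers avoids measurability of operator-valued maps. *)
Lemma measurable_resolvent t i j :
  (t <= m)%N -> (1 <= i <= m)%N -> (1 <= j <= m)%N ->
  measurable_fun [set: GT] (fun w : GT => ip (X i w) (res t w (X j w))).
Proof.
elim: t i j => [|t IH] i j tm im jm.
  under eq_fun do rewrite (ip_resolvent0 ipP)//.
  by apply: measurable_funM => //; apply: measurable_ip; exact: mX.
under eq_fun do rewrite (ip_sherman_morrison ipP)//.
have tm' := ltnW tm.
apply: measurable_funB; first exact: IH.
apply: measurable_funM; first by apply: measurable_funM; exact: IH.
apply: measurable_fun_inv; apply: measurable_funD => //; exact: IH.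
Qed.

(** The times of the operator and of the sum are separate because the predictable part of the
    process pairs [T_(t+1)] with [M_t]. *)
Lemma measurable_ip_Mt t s j : (t <= m)%N -> (s <= m)%N -> (1 <= j <= m)%N ->
  (forall i, (1 <= i <= s)%N -> measurable_fun [set: GT] (eps i : GT -> R)) ->
  measurable_fun [set: GT]
    (fun w : GT => ip (Mt (X ^~ w) (eps ^~ w) s) (res t w (X j w))).
Proof.
move=> tm sm jm meps.
under eq_fun do rewrite (ip_suml ipP).
apply: measurable_fun_sum_nat => i /andP[i1 is_].
under eq_fun do rewrite (ipZl ipP).
apply: measurable_funM; first by apply: meps; rewrite i1.
by apply: measurable_resolvent; rewrite // i1 (leq_trans _ sm).
Qed.

Lemma measurable_norm_Mt t s : (t <= m)%N -> (s <= m)%N ->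
  (forall i, (1 <= i <= s)%N -> measurable_fun [set: GT] (eps i : GT -> R)) ->
  measurable_fun [set: GT]
    (fun w : GT => `|S t w (Mt (X ^~ w) (eps ^~ w) s)|).
Proof.
move=> tm sm meps.
pose f (w : GT) := ip (Mt (X ^~ w) (eps ^~ w) s) (res t w (Mt (X ^~ w) (eps ^~ w) s)).
rewrite (_ : (fun w : GT => _) = fun w : GT => Num.sqrt (f w)); last first.
  apply/funext => w; rewrite /f -(sqr_norm_inv_sqrt ipP)//.
  by rewrite sqrtr_sqr normr_id.
apply: measurable_fun_sqrt; last by move=> w; exact: resolvent_ge0.
rewrite /f; under eq_fun do rewrite (ip_suml ipP).
apply: measurable_fun_sum_nat => i /andP[i1 is_].
under eq_fun do rewrite (ipZl ipP) (ip_resolventC ipP)//.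
apply: measurable_funM; first by apply: meps; rewrite i1.
by apply: measurable_ip_Mt; rewrite // i1 (leq_trans _ sm).
Qed.

Lemma measurable_norm_Gt t : (1 <= t <= m)%N ->
  measurable_fun [set: GT] (fun w : GT => `|Gt ip rho (X ^~ w) t|).
Proof.
move=> /andP[t1 tm].
rewrite (_ : (fun w : GT => _) =
  fun w : GT => Num.sqrt (ip (X t w) (res t w (X t w)))); last first.
  apply/funext => w; rewrite -(sqr_norm_inv_sqrt ipP)//.
  by rewrite sqrtr_sqr normr_id.
apply: measurable_fun_sqrt; last by move=> w; exact: resolvent_ge0.
by apply: measurable_resolvent; rewrite // t1.
Qed.

End Process.
End HilbertMeasurability.

(** * One step of the supermartingale *)

Section SeriesEFin.
Variable R : realType.

Lemma nneseries_EFin (u : nat -> R) (l : R) :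
  series u @ \oo --> l -> (\sum_(k <oo) (u k)%:E = l%:E)%E.
Proof.
move=> ul; apply: cvg_lim => //.
rewrite (_ : (fun k => _) = EFin \o series u).
  by apply: cvg_EFin; [exact: nearW|exact: ul].
by apply/funext => k; rewrite /series /= sumEFin.
Qed.

Lemma expR_tail_series (x : R) :
  series (fun k => x ^+ k.+2 / k.+2`!%:R) @ \oo --> expR x - 1 - x.
Proof.
rewrite (_ : series _ = fun k => series (exp_coeff x) (k + 2)%N - 1 - x).
  apply: cvgB; last exact: cvg_cst.
  apply: cvgB; last exact: cvg_cst.
  by have := @cvg_series_exp_coeff R x; rewrite -(cvg_shiftn 2).
apply/funext => k; rewrite /series/= addn2 !big_nat_recl//=.
by rewrite /exp_coeff/= expr0 expr1 !divr1; ring.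
Qed.

Lemma expR_tail_ge0 (x : R) : 0 <= expR x - 1 - x.
Proof. by have := expR_ge1Dx x; lra. Qed.

End SeriesEFin.

(* If [E |e|^m <= m! B^(m-2) s^2 / 2] for all [m >= 2], then summing the series
   gives [E (exp (lam |e|) - 1 - lam |e|) <= bernstein_rate B lam * s^2]. *)
Definition bernstein_rate (R : realType) (B lam : R) : R :=
  lam ^+ 2 / (2 * (1 - lam * B)).

Lemma bernstein_rate_ge0 (R : realType) (B lam : R) :
  lam * B < 1 -> 0 <= bernstein_rate B lam.
Proof. by move=> h; rewrite divr_ge0 ?sqr_ge0// mulr_ge0// subr_ge0 ltW. Qed.

Section ConditionalStep.
Context (d : measure_display) (Omega : measurableType d) (R : realType).
Variables (G : set (set Omega)) (P : probability Omega R).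
Hypothesis subG : sub_sigma G.
Local Notation GT := (g_sigma_algebraType G).
Variables (e s g : Omega -> R) (B lam : R).
Hypothesis me : measurable_fun [set: Omega] e.
Hypothesis ie : P.-integrable setT (fun w => (e w)%:E).
Hypothesis centered : forall A, G A -> (\int[P]_(w in A) (e w)%:E = 0)%E.
Hypothesis ms : measurable_fun [set: GT] (s : GT -> R).
Hypothesis moments : forall m, (2 <= m)%N -> forall A, G A ->
  (\int[P]_(w in A) (`|e w| ^+ m)%:E <=
   \int[P]_(w in A) (2^-1 * m`!%:R * B ^+ (m - 2) * s w ^+ 2)%:E)%E.
Hypothesis B0 : 0 <= B.
Hypothesis lam0 : 0 <= lam.
Hypothesis lamB : lam * B < 1.
Hypothesis mg : measurable_fun [set: GT] (g : GT -> R).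
Hypothesis g01 : forall w, 0 <= g w <= 1.

Local Notation kap := (bernstein_rate B lam).

Let sub_meas f := @measurable_fun_sub _ _ _ subG _ R f.

Let kap_ge0 : 0 <= kap. Proof. exact: bernstein_rate_ge0. Qed.

(** The exponential tail is integrated term by term; the [k]-th term has the [G]-measurable weight
    [c k], so the moment bound of order [k + 2] applies and its factorial cancels, leaving a
    geometric series. *)
Let integral_exp_tail_le (W : Omega -> R) :
  measurable_fun [set: GT] (W : GT -> R) -> (forall w, 0 <= W w) ->
  (\int[P]_w (W w * (expR (lam * g w * `|e w|) - 1 - lam * g w * `|e w|))%:E <=
   \int[P]_w (W w * (kap * s w ^+ 2 * g w ^+ 2))%:E)%E.
Proof.
move=> mW W0.
have mW' := sub_meas mW; have mg' := sub_meas mg; have ms' := sub_meas ms.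
have g0 w : 0 <= g w by case/andP: (g01 w).
have mabs : measurable_fun [set: Omega] (fun w => `|e w|) by exact: measurableT_comp.
pose c k w := W w * ((lam * g w) ^+ k.+2 / k.+2`!%:R).
have c0 k w : 0 <= c k w by rewrite mulr_ge0// divr_ge0// exprn_ge0// mulr_ge0.
have Y0 w : 0 <= W w * (2^-1 * lam ^+ 2 * g w ^+ 2 * s w ^+ 2).
  by rewrite mulr_ge0// mulr_ge0 ?sqr_ge0// mulr_ge0 ?sqr_ge0// mulr_ge0 ?sqr_ge0.
have mc k : measurable_fun [set: GT] (c k : GT -> R).
  apply: measurable_funM => //; apply: measurable_funM => //.
  by apply: measurable_funX; exact: measurable_funM.
have -> : (\int[P]_w (W w * (expR (lam * g w * `|e w|) - 1 - lam * g w * `|e w|))%:E =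
    \int[P]_w \sum_(k <oo) (c k w * `|e w| ^+ k.+2)%:E)%E.
  apply: eq_integral => w _; apply/esym/nneseries_EFin.
  rewrite (_ : series _ = fun k => W w *
    series (fun k => (lam * g w * `|e w|) ^+ k.+2 / k.+2`!%:R) k).
    by apply: cvgMl_tmp; exact: expR_tail_series.
  apply/funext => k; rewrite /series/= mulr_sumr; apply: eq_bigr => i _.
  by rewrite /c -mulrA; congr (_ * _); rewrite (exprMn _ (lam * g w)) mulrAC.
(* The factor [1 / (1 - lam B)] of [kap] is the sum of the geometric series of ratio [lam B < 1]. *)
have -> : (\int[P]_w (W w * (kap * s w ^+ 2 * g w ^+ 2))%:E =
    \int[P]_w \sum_(k <oo) (W w * (2^-1 * lam ^+ 2 * g w ^+ 2 * s w ^+ 2)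
      * (lam * B) ^+ k)%:E)%E.
  apply: eq_integral => w _; apply/esym/nneseries_EFin.
  have -> : W w * (kap * s w ^+ 2 * g w ^+ 2) =
      W w * (2^-1 * lam ^+ 2 * g w ^+ 2 * s w ^+ 2) * (1 - lam * B)^-1.
    by rewrite /bernstein_rate; field; rewrite subr_eq0 gt_eqF.
  apply: cvg_geometric_series; rewrite ger0_norm//; exact: mulr_ge0.
rewrite !integral_nneseries//=; first last.
- by move=> k w _; rewrite lee_fin mulr_ge0.
- move=> k; apply/measurable_EFinP/measurable_funM; first exact: sub_meas.
  exact: measurable_funX.
- by move=> k w _; rewrite lee_fin mulr_ge0 ?Y0// exprn_ge0// mulr_ge0.
- move=> k; apply/measurable_EFinP/measurable_funM => //.
  apply: measurable_funM => //; apply: measurable_funM; last exact: measurable_funX.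
  by apply: measurable_funM => //; exact: measurable_funX.
apply: lee_nneseries => [k _ _|k _].
  by apply: integral_ge0 => w _; rewrite lee_fin mulr_ge0.
have bnd0 w : 0 <= 2^-1 * k.+2`!%:R * B ^+ (k.+2 - 2) * s w ^+ 2.
  by rewrite mulr_ge0 ?sqr_ge0// mulr_ge0 ?exprn_ge0.
apply: (@le_trans _ _ (\int[P]_w
    (c k w * (2^-1 * k.+2`!%:R * B ^+ (k.+2 - 2) * s w ^+ 2))%:E)%E).
  apply: (le_integral_weight subG) => //.
  - exact: measurable_funX.
  - by apply: measurable_funM => //; exact: measurable_funX.
  - by move=> A GA; exact: moments.
apply: ge0_le_integral => //=.
- by move=> w _; rewrite lee_fin mulr_ge0.
- apply/measurable_EFinP/measurable_funM; first exact: sub_meas.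
  by apply: measurable_funM => //; exact: measurable_funX.
- apply/measurable_EFinP/measurable_funM => //.
  apply: measurable_funM => //; apply: measurable_funM; last exact: measurable_funX.
  by apply: measurable_funM => //; exact: measurable_funX.
move=> w _; rewrite lee_fin /c subn2/=.
have f0 : k.+2`!%:R != 0 :> R by rewrite pnatr_eq0 -lt0n fact_gt0.
(* The surplus factor [g^k] is at most [1]. *)
have -> : W w * ((lam * g w) ^+ k.+2 / k.+2`!%:R) *
    (2^-1 * k.+2`!%:R * B ^+ k * s w ^+ 2) =
    W w * (2^-1 * lam ^+ 2 * g w ^+ 2 * s w ^+ 2) * (lam * B) ^+ k * g w ^+ k.
  by rewrite !exprMn !exprS expr0; field.
rewrite ler_piMr ?exprn_ile1//; last by case/andP: (g01 w).
by rewrite mulr_ge0 ?Y0// exprn_ge0// mulr_ge0.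
Qed.

Let pos (f : Omega -> R) w := Num.max (f w) 0.

Let pos_ge0 f w : 0 <= pos f w. Proof. by rewrite le_max lexx orbT. Qed.

Let posB f w : pos f w - pos (\- f) w = f w.
Proof.
rewrite /pos/= !maxEle oppr_le0; case: (leP (f w) 0); case: (leP 0 (f w)) => *; lra.
Qed.

Let posD f w : pos f w + pos (\- f) w = `|f w|.
Proof.
rewrite /pos/=; have /orP[f0|f0] := le_total 0 (f w).
  by rewrite max_l// max_r ?oppr_le0// addr0 ger0_norm.
by rewrite max_r// max_l ?oppr_ge0// add0r ler0_norm.
Qed.

Let mpos_e : measurable_fun [set: Omega] (pos e).
Proof. exact: measurable_maxr. Qed.

Let mneg_e : measurable_fun [set: Omega] (pos (\- e)).
Proof. by apply: measurable_maxr => //; exact: measurableT_comp. Qed.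

(** Centering is stated as equality for the positive and negative parts, so that weights are
    inserted under nonnegative integrals only. On sets of [G] it follows by adding the finite
    integral of the negative part. *)
Let centered_weight (W : Omega -> R) :
  measurable_fun [set: GT] (W : GT -> R) -> (forall w, 0 <= W w) ->
  (\int[P]_w (W w * pos e w)%:E = \int[P]_w (W w * pos (\- e) w)%:E)%E.
Proof.
move=> mW W0.
have E A : G A -> (\int[P]_(w in A) (pos e w)%:E = \int[P]_(w in A) (pos (\- e) w)%:E)%E.
  move=> GA; have mA : measurable A by exact: subG.2.
  have ieA : P.-integrable A (fun w => (e w)%:E) by exact: integrableS ie.
  have fin : (\int[P]_(w in A) ((fun w => (e w)%:E) ^\- w))%E \is a fin_num.
    exact/integrable_fin_num/integrable_funeneg.
  have -> : (\int[P]_(w in A) (pos e w)%:E =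
      \int[P]_(w in A) ((fun w => (e w)%:E) ^\+ w))%E.
    by apply: eq_integral => w _; rewrite funeposE /pos EFin_max.
  have -> : (\int[P]_(w in A) (pos (\- e) w)%:E =
      \int[P]_(w in A) ((fun w => (e w)%:E) ^\- w))%E.
    by apply: eq_integral => w _; rewrite funenegE /pos EFin_max EFinN.
  by rewrite -[LHS](subeK _ fin) -integralE (centered GA) add0e.
apply/eqP; rewrite eq_le; apply/andP; split; apply: (le_integral_weight subG) => //;
  by move=> A /E ->.
Qed.

(** The term [L e] is split as [I1 - I2] with nonnegative [I1], [I2] of equal integral. [I2] is
    moved to the left, everything is integrated, and the common value cancels because [|L| <= K]
    makes it finite. *)
Lemma conditional_step (f W L : Omega -> R) (K : R) :
  measurable_fun [set: Omega] f -> (forall w, 0 <= f w) ->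
  measurable_fun [set: GT] (W : GT -> R) -> (forall w, 0 <= W w) ->
  measurable_fun [set: GT] (L : GT -> R) -> (forall w, `|L w| <= K) ->
  (forall w, f w <=
     W w * (expR (lam * g w * `|e w|) - lam * g w * `|e w|) + L w * e w) ->
  (\int[P]_w (f w)%:E <= \int[P]_w (W w * (1 + kap * s w ^+ 2 * g w ^+ 2))%:E)%E.
Proof.
move=> mf f0 mW W0 mL LK fle.
have mW' := sub_meas mW; have mg' := sub_meas mg; have ms' := sub_meas ms.
have mpL : measurable_fun [set: GT] (pos L : GT -> R) by exact: measurable_maxr.
have mnL : measurable_fun [set: GT] (pos (\- L) : GT -> R).
  by apply: measurable_maxr => //; exact: measurableT_comp.
have mpL' := sub_meas mpL; have mnL' := sub_meas mnL.
pose psi w := expR (lam * g w * `|e w|) - 1 - lam * g w * `|e w|.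
have psi0 w : 0 <= psi w by exact: expR_tail_ge0.
have mx : measurable_fun [set: Omega] (fun w => lam * g w * `|e w|).
  by apply: measurable_funM; [exact: measurable_funM|exact: measurableT_comp].
have mpsi : measurable_fun [set: Omega] psi.
  apply: measurable_funB => //; apply: measurable_funB => //; exact: measurableT_comp.
pose I1 w := pos L w * pos e w + pos (\- L) w * pos (\- e) w.
pose I2 w := pos L w * pos (\- e) w + pos (\- L) w * pos e w.
have I10 w : 0 <= I1 w by rewrite addr_ge0// mulr_ge0.
have I20 w : 0 <= I2 w by rewrite addr_ge0// mulr_ge0.
have mI1 : measurable_fun [set: Omega] I1 by apply: measurable_funD; exact: measurable_funM.
have mI2 : measurable_fun [set: Omega] I2 by apply: measurable_funD; exact: measurable_funM.
have I12 : (\int[P]_w (I1 w)%:E = \int[P]_w (I2 w)%:E)%E.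
  rewrite /I1 /I2; under eq_integral do rewrite EFinD.
  under [RHS]eq_integral do rewrite EFinD.
  rewrite !ge0_integralD//=; try by
    (move=> w _; rewrite lee_fin mulr_ge0) || (apply/measurable_EFinP; exact: measurable_funM).
  by rewrite !centered_weight.
have K0 : 0 <= K by rewrite (le_trans _ (LK point)).
have I1fin : (\int[P]_w (I1 w)%:E < +oo)%E.
  apply: (@le_lt_trans _ _ (\int[P]_w (K%:E * `|(e w)%:E|))%E).
    apply: ge0_le_integral => //=.
    - by move=> w _; rewrite lee_fin.
    - exact/measurable_EFinP.
    - by apply/measurable_EFinP/measurable_funM => //; exact: measurableT_comp.
    move=> w _; rewrite lee_fin.
    apply: le_trans (ler_wpM2r (normr_ge0 (e w)) (LK w)); rewrite /I1.
    (* [|L| |e| = I1 + I2]. *)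
    rewrite -(posD L) -(posD e) -subr_ge0.
    apply: le_trans (I20 w) _; rewrite le_eqVlt; apply/orP; left; apply/eqP.
    by rewrite /I2; ring.
  rewrite ge0_integralZl//=; last exact/measurable_EFinP/measurableT_comp.
  by rewrite lte_mul_pinfty//; case/integrableP : ie.
have : (\int[P]_w (f w + I2 w)%:E <= \int[P]_w (W w + W w * psi w + I1 w)%:E)%E.
  apply: ge0_le_integral => //=.
  - by move=> w _; rewrite lee_fin addr_ge0.
  - exact/measurable_EFinP/measurable_funD.
  - apply/measurable_EFinP/measurable_funD => //; apply: measurable_funD => //.
    exact: measurable_funM.
  move=> w _; rewrite lee_fin.
  have : L w * e w = I1 w - I2 w.
    by rewrite -(posB L) -(posB e) /I1 /I2; ring.
  by have := fle w; rewrite /psi; lra.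
have -> : (\int[P]_w (f w + I2 w)%:E = \int[P]_w (f w)%:E + \int[P]_w (I2 w)%:E)%E.
  under eq_integral do rewrite EFinD.
  by rewrite ge0_integralD//=;
    [by move=> w _; rewrite lee_fin|exact/measurable_EFinP
    |by move=> w _; rewrite lee_fin|exact/measurable_EFinP].
have mWpsi : measurable_fun [set: Omega] (fun w => W w * psi w) by exact: measurable_funM.
have Wpsi0 w : 0 <= W w * psi w by rewrite mulr_ge0.
have -> : (\int[P]_w (W w + W w * psi w + I1 w)%:E =
    \int[P]_w (W w)%:E + \int[P]_w (W w * psi w)%:E + \int[P]_w (I1 w)%:E)%E.
  under eq_integral do rewrite 2!EFinD.
  rewrite ge0_integralD//=;
    [|by move=> w _; rewrite -EFinD lee_fin addr_ge0
     |exact/measurable_EFinP/measurable_funD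
     |by move=> w _; rewrite lee_fin|exact/measurable_EFinP].
  by rewrite ge0_integralD//=;
    [by move=> w _; rewrite lee_fin|exact/measurable_EFinP
    |by move=> w _; rewrite lee_fin|exact/measurable_EFinP].
rewrite -I12 leeD2rE; last first.
  by rewrite ge0_fin_numE//; apply: integral_ge0 => w _; rewrite lee_fin.
move=> /le_trans; apply.
under [leRHS]eq_integral do rewrite mulrDr mulr1 EFinD.
rewrite [leRHS]ge0_integralD//=.
- exact/leeD2l/integral_exp_tail_le.
- by move=> w _; rewrite lee_fin.
- exact/measurable_EFinP.
- by move=> w _; rewrite lee_fin mulr_ge0// mulr_ge0 ?sqr_ge0// mulr_ge0 ?sqr_ge0.
- apply/measurable_EFinP/measurable_funM => //; apply: measurable_funM.
    by apply: measurable_funM => //; exact: measurable_funX.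
  exact: measurable_funX.
Qed.

End ConditionalStep.

(** The sign of [Y] is unknown, so its integral is first bounded by that of its positive part, which
    is still below [b] almost everywhere. *)
Lemma le_integral_cond_exp (d : measure_display) (Omega : measurableType d)
    (R : realType) (P : probability Omega R) (G : set (set Omega))
    (Xv Y : Omega -> \bar R) (b : Omega -> R) A :
  sub_sigma G -> is_cond_exp P G Xv Y ->
  measurable_fun [set: Omega] b -> (forall w, 0 <= b w) ->
  {ae P, forall w, (Y w <= (b w)%:E)%E} -> G A ->
  (\int[P]_(w in A) Xv w <= \int[P]_(w in A) (b w)%:E)%E.
Proof.
move=> subG [mY XY] mb b0 Yb GA; have mA : measurable A by exact: subG.2.
have mY' : measurable_fun [set: Omega] Y.
  by apply: (measurable_fun_sub subG); apply/measurable_wrtP.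
rewrite XY// integralE.
apply: (@le_trans _ _ (\int[P]_(w in A) (Y^\+)%E w)%E).
  by rewrite geeDl// oppe_le0 integral_ge0.
apply: ae_ge0_le_integral => //.
- exact/measurable_funepos/measurable_funTS.
- by move=> w _; rewrite lee_fin.
- exact/measurable_EFinP/measurable_funTS.
move: Yb; apply: filterS => w Yb _.
by rewrite funeposE ge_max Yb lee_fin b0.
Qed.

(** * The self-normalized process *)

Section SelfNormalized.
Variables (R : realType) (H : normedModType R) (ip : H -> H -> R).
Context (d : measure_display) (Omega : measurableType d).
Variables (P : probability Omega R) (n : nat) (X : nat -> Omega -> H).
Variables (eps : nat -> Omega -> R) (F : nat -> set (set Omega)).
Variables (B : R) (sigma : nat -> Omega -> R) (rho : R).
Hypothesis ipP : is_inner_product ip.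
Hypothesis sepH : separable_space H.
Hypothesis filtF : filtration F.
Hypothesis adX : forall t, (1 <= t <= n)%N -> Hmeasurable_wrt (F t.-1) (X t).
Hypothesis adeps : forall t, (1 <= t <= n)%N -> measurable_wrt (F t) (eps t).
Hypothesis centered : forall t, (1 <= t <= n)%N ->
  P.-integrable setT (fun w => (eps t w)%:E) /\
  is_cond_exp P (F t.-1) (fun w => (eps t w)%:E) (fun _ => 0%E).
Hypothesis B_ge0 : 0 <= B.
Hypothesis adsigma : forall i, (1 <= i <= n)%N -> measurable_wrt (F i.-1) (sigma i).
Hypothesis moments : forall i, (1 <= i <= n)%N -> forall m : nat, (2 <= m)%N ->
  exists Y : Omega -> \bar R,
    is_cond_exp P (F i.-1) (fun w => (`|eps i w| ^+ m)%:E) Y /\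
    {ae P, forall w, (Y w <= (2^-1 * (m`!)%:R * B ^+ (m - 2)
                               * sigma i w ^+ 2)%:E)%E}.
Hypothesis rho_gt0 : 0 < rho.

Local Notation FT t := (g_sigma_algebraType (F t)).
Local Notation S t w := (inv_sqrt ip (shiftV ip rho (X ^~ w) t)).
Local Notation M t w := (Mt (X ^~ w) (eps ^~ w) t).

Let Z t w := `|S t w (M t w)|.
Let g t w := `|Gt ip rho (X ^~ w) t|.

Let subF t : sub_sigma (F t). Proof. by case: filtF. Qed.

Let FS s t : (s <= t)%N -> F s `<=` F t. Proof. by case: filtF => _; apply. Qed.

Let mX t i : (i <= t.+1)%N -> (1 <= i <= n)%N -> Hmeasurable_wrt (F t) (X i).
Proof.
move=> it /[dup] i1n /andP[i1 _] U oU; apply: (@FS i.-1 t); last exact: adX.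
by case: i it i1 {i1n}.
Qed.

Let meps t i : (i <= t)%N -> (1 <= i <= n)%N ->
  measurable_fun [set: FT t] (eps i : FT t -> R).
Proof.
move=> it i1n; apply/(measurable_wrtP (subF t)) => U mU.
by apply: (FS it); exact: adeps.
Qed.

Let msigma t i : (i <= t.+1)%N -> (1 <= i <= n)%N ->
  measurable_fun [set: FT t] (sigma i : FT t -> R).
Proof.
move=> it /[dup] i1n /andP[i1 _]; apply/(measurable_wrtP (subF t)) => U mU.
apply: (@FS i.-1 t); last exact: adsigma.
by case: i it i1 {i1n}.
Qed.

Let mZ t : (t <= n)%N -> measurable_fun [set: FT t] (Z t : FT t -> R).
Proof.
move=> tn; apply: (measurable_norm_Mt (m := t) ipP sepH (subF t) rho_gt0) => //.
  by move=> i /andP[i1 it]; apply: mX; rewrite ?i1 ?(leq_trans it)// ltnW.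
by move=> i /andP[i1 it]; apply: meps; rewrite // i1 (leq_trans it).
Qed.

Let mg t i : (1 <= i <= t.+1)%N -> (t.+1 <= n)%N ->
  measurable_fun [set: FT t] (g i : FT t -> R).
Proof.
move=> i1t tn; apply: (measurable_norm_Gt (m := t.+1) ipP sepH (subF t)) => //.
by move=> j /andP[j1 jt]; apply: mX; rewrite // j1 (leq_trans jt).
Qed.

Lemma measurable_sup_self_norm : measurable_fun [set: Omega]
  (fun w => sup_self_norm ip rho (X ^~ w) (eps ^~ w) n).
Proof.
rewrite /sup_self_norm; elim: (index_enum _) => [|k l IH].
  by under eq_fun do rewrite big_nil; exact: measurable_cst.
under eq_fun do rewrite big_cons.
apply: measurable_maxr; last exact: IH.
by apply: (measurable_fun_sub (subF k)); apply: mZ; rewrite -ltnS.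
Qed.

(** * The stopped supermartingale and its maximal inequality *)

Section Supermartingale.
Variables (lam r C : R).
Hypothesis lam_ge0 : 0 <= lam.
Hypothesis lamB : lam * B < 1.
Hypothesis r_gt0 : 0 < r.
Hypothesis sumC : {ae P, forall w, \sum_(1 <= i < n.+1)
  sigma i w ^+ 2 * `|Gt ip rho (X ^~ w) i| ^+ 2 <= C ^+ 2}.

Local Notation kap := (bernstein_rate B lam).
Let D t w := expR (- (kap * \sum_(1 <= i < t.+1) sigma i w ^+ 2 * g i w ^+ 2)).
Let Phi t w := cosh (lam * Z t w) * D t w.

(** The event, in [F_t], that [Z] has not reached [r] up to time [t]; it encodes the stopping
    time. *)
Let below := fix below t w :=
  (if t is t'.+1 then below t' w else true) && (Z t w < r).

Let belowZ t w : below t w -> Z t w < r.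
Proof. by case: t => [|t] /andP[]. Qed.

Let kap_ge0 : 0 <= kap. Proof. exact: bernstein_rate_ge0. Qed.

Let sum_ge0 t w : 0 <= \sum_(1 <= i < t.+1) sigma i w ^+ 2 * g i w ^+ 2.
Proof. by rewrite sumr_ge0// => i _; rewrite mulr_ge0// sqr_ge0. Qed.

Let Phi_ge0 t w : 0 <= Phi t w.
Proof. by rewrite mulr_ge0 ?cosh_ge0 ?expR_ge0. Qed.

Let mbelow t : (t <= n)%N -> measurable_fun [set: FT t] (below t : FT t -> bool).
Proof.
elim: t => [|t IH] tn; apply: measurable_and => //.
- by apply: measurable_fun_ltr => //; exact: mZ.
- apply/(measurable_wrtP (subF _)) => U mU; apply: (FS (leqnSn t)).
  by have /(measurable_wrtP (subF t)) := IH (ltnW tn); apply.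
- by apply: measurable_fun_ltr => //; exact: mZ.
Qed.

Let mD t : (t < n)%N -> measurable_fun [set: FT t] (D t.+1 : FT t -> R).
Proof.
move=> tn; apply: measurableT_comp => //; apply: measurableT_comp => //.
apply: measurable_funM => //; apply: measurable_fun_sum_nat => i i1t.
have /andP[i1 it] := i1t.
apply: measurable_funM; apply: measurable_funX; last exact: mg.
by apply: msigma; rewrite // i1/= (leq_trans _ tn).
Qed.

Let mPhi t : (t <= n)%N -> measurable_fun [set: Omega] (Phi t).
Proof.
move=> tn; apply: measurable_funM.
  apply: measurable_fun_cosh; apply: measurable_funM => //.
  by apply: (measurable_fun_sub (subF t)); exact: mZ.
case: t tn => [|t] tn; last first.
  by apply: (measurable_fun_sub (subF t)); exact: mD.
by rewrite /D; under eq_fun do rewrite big_geq//; exact: measurable_cst.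
Qed.

(** Pinelis' inequality with [u = lam T_(t+1)^(-1/2) M_t] and [v = lam eps_(t+1) G_(t+1)] puts
    [Phi_(t+1)] in the form required by [conditional_step]: [W] collects the factor [cosh |u|] and
    [L] the coefficient of [eps_(t+1)]. *)
Let step t : (t < n)%N ->
  (\int[P]_w (if below t w then Phi t.+1 w else 0)%:E <=
   \int[P]_w (if below t w then Phi t w else 0)%:E)%E.
Proof.
move=> tn; have t1n : (1 <= t.+1 <= n)%N by [].
pose U w := `|S t.+1 w (M t w)|.
pose q w := ip (M t w) (resolvent ip rho (X ^~ w) t.+1 (X t.+1 w)).
pose W w := if below t w then cosh (lam * U w) * D t.+1 w else 0.
pose L w := if below t w then
  D t.+1 w * (sinh (lam * U w) / (lam * U w) * (lam ^+ 2 * q w)) else 0.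
have mXt i : (1 <= i <= t.+1)%N -> Hmeasurable_wrt (F t) (X i).
  by move=> /andP[i1 it]; apply: mX; rewrite // i1 (leq_trans it).
have mepst i : (1 <= i <= t)%N -> measurable_fun [set: FT t] (eps i : FT t -> R).
  by move=> /andP[i1 it]; apply: meps; rewrite // i1 (leq_trans it)// ltnW.
have mU : measurable_fun [set: FT t] (U : FT t -> R).
  by apply: (measurable_norm_Mt (m := t.+1) ipP sepH (subF t) rho_gt0).
have mlU : measurable_fun [set: FT t] ((fun w => lam * U w) : FT t -> R).
  exact: measurable_funM.
have mq : measurable_fun [set: FT t] (q : FT t -> R).
  by apply: (measurable_ip_Mt (m := t.+1) ipP sepH (subF t) rho_gt0) => //; rewrite ?leqnn ?leqnSn. 
have mb := mbelow (ltnW tn).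
have mW : measurable_fun [set: FT t] (W : FT t -> R).
  apply: measurable_fun_ifT => //; apply: measurable_funM; last exact: mD.
  exact: measurable_fun_cosh.
have mL : measurable_fun [set: FT t] (L : FT t -> R).
  apply: measurable_fun_ifT => //; apply: measurable_funM; first exact: mD.
  apply: measurable_funM; last exact: measurable_funM.
  by apply: measurable_funM; [exact: measurable_fun_sinh|exact: measurable_fun_inv].
have W0 w : 0 <= W w by rewrite /W; case: ifP => // _; rewrite mulr_ge0 ?cosh_ge0 ?expR_ge0.
have g01 w : 0 <= g t.+1 w <= 1 by rewrite normr_ge0 norm_Gt_le1.
have U0 w : 0 <= U w by exact: normr_ge0.
have UZ w : U w <= Z t w by exact: norm_inv_sqrtS_le.
have D1 w : D t.+1 w <= 1 by rewrite expR_le1 oppr_le0 mulr_ge0.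
have qE w : q w = ip (S t.+1 w (M t w)) (Gt ip rho (X ^~ w) t.+1).
  by rewrite /Gt (ip_inv_sqrt ipP).
(* Stopping is what bounds [L]: before the crossing [U <= Z_t < r]. *)
have LK w : `|L w| <= cosh (lam * r) * lam.
  rewrite /L; case: ifP => [bw|_]; last by rewrite normr0 mulr_ge0// cosh_ge0.
  have x0 : 0 <= lam * U w by rewrite mulr_ge0.
  have qU : `|q w| <= U w.
    rewrite qE (le_trans (normr_ip_le ipP _ _))// ler_piMr//.
    by case/andP: (g01 w).
  rewrite normrM ger0_norm ?expR_ge0// -[leRHS]mul1r ler_pM ?expR_ge0//.
  apply: (@le_trans _ _ (cosh (lam * U w) * lam)); last first.
    rewrite ler_wpM2r// cosh_le// ler_wpM2l//.
    by rewrite (le_trans (UZ w))// ltW// belowZ.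
  have [->|xn0] := eqVneq (lam * U w) 0.
    by rewrite invr0 mulr0 mul0r normr0 mulr_ge0// cosh_ge0.
  rewrite -mulrA normrM ler_pM ?norm_sinh_le_cosh// normrM normfV (ger0_norm x0).
  rewrite ler_pdivrMl ?lt_neqAle 1?eq_sym ?xn0// normrM ger0_norm ?sqr_ge0//.
  by rewrite [leRHS]mulrAC -[lam * lam]expr2 ler_wpM2l// sqr_ge0.
have key w : (if below t w then Phi t.+1 w else 0) <=
    W w * (expR (lam * g t.+1 w * `|eps t.+1 w|) - lam * g t.+1 w * `|eps t.+1 w|)
      + L w * eps t.+1 w.
  rewrite /W /L; case: ifP => _; last by rewrite !mul0r addr0.
  pose u := lam *: S t.+1 w (M t w).
  pose v := (lam * eps t.+1 w) *: Gt ip rho (X ^~ w) t.+1.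
  have uE : `|u| = lam * U w by rewrite normrZ ger0_norm.
  have vE : `|v| = lam * g t.+1 w * `|eps t.+1 w|.
    by rewrite normrZ normrM ger0_norm// mulrAC.
  have uvE : `|u + v| = lam * Z t.+1 w.
    have -> : u + v = lam *: S t.+1 w (M t.+1 w).
      have -> : M t.+1 w = M t w + eps t.+1 w *: X t.+1 w.
        by rewrite /Mt big_nat_recr.
      by rewrite (inv_sqrtD ipP)// (inv_sqrtZ ipP)// scalerDr scalerA.
    by rewrite normrZ ger0_norm.
  have := cosh_normD_le ipP u v; rewrite uE vE uvE.
  rewrite (ipZl ipP) (ipZr ipP) -qE => h.
  have := ler_wpM2r (expR_ge0 _ : 0 <= D t.+1 w) h.
  move=> /le_trans; apply; rewrite le_eqVlt; apply/orP; left; apply/eqP.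
  by ring.
have [ie ce] := centered t1n.
have me : measurable_fun [set: Omega] (eps t.+1).
  by apply: (measurable_fun_sub (subF t.+1)); exact: meps.
have ms : measurable_fun [set: FT t] (sigma t.+1 : FT t -> R) by exact: msigma.
have mgt : measurable_fun [set: FT t] (g t.+1 : FT t -> R).
  by apply: mg => //; rewrite leqnn.
have ms' := measurable_fun_sub (subF t) ms.
have mgt' := measurable_fun_sub (subF t) mgt.
have mb' := measurable_fun_sub (subF t) mb.
have cent A : F t A -> (\int[P]_(w in A) (eps t.+1 w)%:E = 0)%E.
  by case: ce => _ /(_ A) ceA /ceA ->; rewrite integral0.
have mom m : (2 <= m)%N -> forall A, F t A ->
  (\int[P]_(w in A) (`|eps t.+1 w| ^+ m)%:E <=
   \int[P]_(w in A) (2^-1 * m`!%:R * B ^+ (m - 2) * sigma t.+1 w ^+ 2)%:E)%E.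
  move=> m2 A FA; have [Y [cY Yle]] := moments t1n m2.
  apply: (le_integral_cond_exp (subF t) cY _ _ Yle FA).
    by apply: measurable_funM => //; exact: measurable_funX.
  by move=> w; rewrite mulr_ge0 ?sqr_ge0// mulr_ge0 ?exprn_ge0.
have mf : measurable_fun [set: Omega] (fun w => if below t w then Phi t.+1 w else 0).
  by apply: measurable_fun_ifT => //; exact: mPhi.
have f0 w : 0 <= (if below t w then Phi t.+1 w else 0) by case: ifP.
apply: le_trans (conditional_step (subF t) me ie cent ms mom B_ge0 lam_ge0 lamB
  mgt g01 mf f0 mW W0 mL LK key) _.
have y0 w : 0 <= kap * sigma t.+1 w ^+ 2 * g t.+1 w ^+ 2.
  by rewrite mulr_ge0 ?sqr_ge0// mulr_ge0 ?sqr_ge0.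
apply: ge0_le_integral => //=.
- by move=> w _; rewrite lee_fin mulr_ge0// addr_ge0.
- apply/measurable_EFinP/measurable_funM; first exact: (measurable_fun_sub (subF t)).
  apply: measurable_funD => //; apply: measurable_funM; last exact: measurable_funX.
  by apply: measurable_funM => //; exact: measurable_funX.
- by apply/measurable_EFinP/measurable_fun_ifT => //; apply: mPhi; exact: ltnW.
(* [cosh (lam U) <= cosh (lam Z_t)], and [D_(t+1) (1 + y) = D_t e^(-y) (1 + y) <= D_t]. *)
move=> w _; rewrite lee_fin /W; case: ifP => _; last by rewrite mul0r.
rewrite -mulrA ler_pM ?cosh_ge0 ?mulr_ge0 ?expR_ge0 ?addr_ge0//.
  by rewrite cosh_le ?mulr_ge0// ler_wpM2l.
set y := kap * _ * _.
have -> : D t.+1 w = D t w * expR (- y).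
  by rewrite /D big_nat_recr//= mulrDr opprD expRD mulrA.
rewrite -mulrA ler_piMr ?expR_ge0//.
by rewrite -[leRHS](expRxMexpNx_1 y) mulrC ler_wpM2r ?expR_ge0// expR_ge1Dx.
Qed.

Let below_sup w :
  below n w = (sup_self_norm ip rho (X ^~ w) (eps ^~ w) n < r).
Proof.
have belowP t : reflect (forall s, (s <= t)%N -> Z s w < r) (below t w).
  elim: t => [|t IH] /=.
    by apply: (iffP idP) => [h s|]; [rewrite leqn0 => /eqP ->|apply].
  apply: (iffP andP) => [[/IH h Zt] s|h].
    by rewrite leq_eqVlt => /predU1P[->//|]; exact: h.
  by split; [apply/IH => s st; apply: h; exact: ltnW|exact: h].
apply/idP/bigmax_ltP => [/belowP h|[_ h]].
  by split => // i _; apply: h; rewrite -ltnS.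
by apply/belowP => s sn; exact: (h (Ordinal (sn : (s < n.+1)%N))).
Qed.

(** Markov's inequality for the stopped process, whose value after the crossing is replaced by the
    deterministic lower bound [c]. *)
Lemma tail_bound :
  (P [set w | (r <= sup_self_norm ip rho (X ^~ w) (eps ^~ w) n)%R] <=
   (2 * expR (- (lam * r) + kap * C ^+ 2))%:E)%E.
Proof.
pose c := cosh (lam * r) * expR (- (kap * C ^+ 2)).
have c_gt0 : 0 < c by rewrite mulr_gt0 ?expR_gt0// cosh_gt0.
pose Hf t w := if below t w then Phi t w else c.
have Hf0 t w : 0 <= Hf t w by rewrite /Hf; case: ifP => // _; exact: ltW.
have mbelow' t : (t <= n)%N -> measurable_fun [set: Omega] (below t).
  by move=> tn; apply: (measurable_fun_sub (subF t)); exact: mbelow.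
have mHf t : (t <= n)%N -> measurable_fun [set: Omega] (Hf t).
  by move=> tn; apply: measurable_fun_ifT => //; [exact: mbelow'|exact: mPhi].
have splitI t (f : Omega -> R) : (t <= n)%N -> measurable_fun [set: Omega] f ->
    (forall w, 0 <= f w) ->
    (\int[P]_w (if below t w then f w else c)%:E =
     \int[P]_w (if below t w then f w else 0)%:E +
     \int[P]_w (if below t w then 0 else c)%:E)%E.
  move=> tn mf f0; have mb := mbelow' _ tn.
  rewrite -ge0_integralD//=.
  - by apply: eq_integral => w _; case: ifP => _; rewrite -EFinD ?addr0 ?add0r.
  - by move=> w _; rewrite lee_fin; case: ifP.
  - exact/measurable_EFinP/measurable_fun_ifT.
  - by move=> w _; rewrite lee_fin; case: ifP => // _; exact: ltW.
  - exact/measurable_EFinP/measurable_fun_ifT.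
(* If the crossing happens at time [t + 1], then [c <= Phi_(t+1)] almost surely by [sumC]; before
   it, [step] applies. *)
have HS t : (t < n)%N -> (\int[P]_w (Hf t.+1 w)%:E <= \int[P]_w (Hf t w)%:E)%E.
  move=> tn; apply: (@le_trans _ _
    (\int[P]_w (if below t w then Phi t.+1 w else c)%:E)%E).
    apply: ae_ge0_le_integral => //=.
    - by move=> w _; rewrite lee_fin.
    - exact/measurable_EFinP/mHf.
    - by move=> w _; rewrite lee_fin; case: ifP => // _; exact: ltW.
    - apply/measurable_EFinP/measurable_fun_ifT => //; last exact: mPhi.
      by apply: mbelow'; exact: ltnW.
    move: sumC; apply: filterS => w wC _; rewrite lee_fin /Hf /=.
    case: (below t w) => //=; case: ltP => // rZ.
    rewrite ler_pM ?cosh_ge0 ?expR_ge0// ?cosh_le ?mulr_ge0 ?(ltW r_gt0) ?ler_wpM2l//.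
    rewrite ler_expR lerN2 ler_wpM2l// (le_trans _ wC)//.
    rewrite (big_cat_nat (n := t.+2) _ (p := n.+1))//= lerDl sumr_ge0// => i _.
    by rewrite mulr_ge0// sqr_ge0.
  rewrite (splitI t (Phi t.+1)) ?(ltnW tn)//; last exact: mPhi.
  rewrite /Hf (splitI t (Phi t)) ?(ltnW tn)//; last by apply: mPhi; exact: ltnW.
  by rewrite leeD2r// step.
have H1 t : (t <= n)%N -> (\int[P]_w (Hf t w)%:E <= 1)%E.
  elim: t => [|t IH] tn; last exact: le_trans (HS _ tn) (IH (ltnW tn)).
  rewrite (_ : (\int[P]_w (Hf 0 w)%:E = \int[P]_w (cst 1 w))%E).
    by rewrite integral_cst//= mul1e probability_setT.
  apply: eq_integral => w _; rewrite /Hf/=.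
  have Z0 : Z 0 w = 0.
    rewrite /Z /Mt big_geq//.
    by rewrite -(scale0r (0 : H)) (inv_sqrtZ ipP)// scale0r normr0.
  by rewrite Z0 r_gt0 /Phi Z0 mulr0 cosh0 mul1r /D big_geq// mulr0 oppr0 expR0.
set A := [set w | _].
have mA : measurable A.
  rewrite (_ : A = setT `&` (fun w => sup_self_norm ip rho (X ^~ w) (eps ^~ w) n)
    @^-1` `[r, +oo[); first exact: measurable_sup_self_norm.
  by rewrite setTI; apply/seteqP; split => w /=; rewrite in_itv/= andbT.
(* [Hf n] equals [c] on [A] and has integral at most [1]. *)
have cPA : (c%:E * P A <= 1)%E.
  apply: le_trans (H1 n (leqnn n)); rewrite -(setIT A) -integral_indic//.
  rewrite -ge0_integralZl//=; last 2 first.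
  - exact/measurable_EFinP/measurable_indic.
  - by rewrite lee_fin ltW.
  apply: ge0_le_integral => //=.
  - by move=> w _; rewrite mule_ge0 ?lee_fin// ltW.
  - by apply/measurable_EFinP/measurable_funM => //; exact: measurable_indic.
  - exact/measurable_EFinP/mHf.
  move=> w _; rewrite -EFinM lee_fin indicE /Hf below_sup ltNge.
  have [/[!inE] Aw|_] := boolP (w \in A).
    by rewrite mulr1; move: Aw; rewrite /A/= => ->.
  by rewrite mulr0; case: ifP => // _; exact: ltW.
have -> : P A = ((c^-1)%:E * (c%:E * P A))%E.
  by rewrite muleA -EFinM mulVf ?gt_eqF// mul1e.
apply: (@le_trans _ _ (c^-1)%:E).
  by rewrite -[leRHS]mule1 lee_wpmul2l// lee_fin invr_ge0 ltW.
(* The factor [2] comes from [cosh x >= e^x / 2]. *)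
rewrite lee_fin /c invfM -expRN opprK expRD mulrA ler_wpM2r ?expR_ge0//.
rewrite expRN -[2]invrK -invfM lef_pV2 ?posrE ?cosh_gt0 ?mulr_gt0 ?expR_gt0//.
by rewrite /cosh mulrC ler_wpM2r// lerDl expR_ge0.
Qed.

End Supermartingale.

End SelfNormalized.

(** * The two bounds by choice of [lam] *)

Theorem theorem2 (R : realType) (H : completeNormedModType R)
  (ip : H -> H -> R) (d : measure_display) (Omega : measurableType d)
  (P : probability Omega R) (n : nat) (X : nat -> Omega -> H)
  (eps : nat -> Omega -> R) (F : nat -> set (set Omega))
  (B : R) (sigma : nat -> Omega -> R) (rho Cn : R) :
  is_inner_product ip -> separable_space H ->
  (0 < n)%N ->
  filtration F ->
  (forall t, (1 <= t <= n)%N -> Hmeasurable_wrt (F t.-1) (X t)) ->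
  (forall t, (1 <= t <= n)%N -> measurable_wrt (F t) (eps t)) ->
  (forall t, (1 <= t <= n)%N ->
     P.-integrable setT (fun w => (eps t w)%:E) /\
     is_cond_exp P (F t.-1) (fun w => (eps t w)%:E) (fun _ => 0%E)) ->
  0 <= B ->
  (forall i, (1 <= i <= n)%N -> measurable_wrt (F i.-1) (sigma i)) ->
  (forall i, (1 <= i <= n)%N -> forall m : nat, (2 <= m)%N ->
     exists Y : Omega -> \bar R,
       is_cond_exp P (F i.-1) (fun w => (`|eps i w| ^+ m)%:E) Y /\
       {ae P, forall w, (Y w <= (2^-1 * (m`!)%:R * B ^+ (m - 2)
                                  * sigma i w ^+ 2)%:E)%E}) ->
  0 < rho -> 0 <= Cn ->
  {ae P, forall w, \sum_(1 <= i < n.+1)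
      sigma i w ^+ 2 * `| Gt ip rho (X ^~ w) i | ^+ 2 <= Cn ^+ 2} ->
  (forall delta : R, 0 < delta < 1 ->
     ((1 - delta)%:E <=
      P [set w | (sup_self_norm ip rho (X ^~ w) (eps ^~ w) n <=
                 B * ln (2 / delta) + Cn * Num.sqrt (2 * ln (2 / delta)))%R])%E)
  /\
  (forall r : R, 0 <= r ->
     (P [set w | (r <= sup_self_norm ip rho (X ^~ w) (eps ^~ w) n)%R] <=
      (2 * expR (- (r ^+ 2 / (2 * (Cn ^+ 2 + B * r)))))%:E)%E).
Proof.
move=> ipP sepH n_gt0 filtF adX adeps cent B0 adsigma mom rho0 Cn0 sumC.
pose sup w := sup_self_norm ip rho (X ^~ w) (eps ^~ w) n.
have msup : measurable_fun [set: Omega] sup.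
  exact: (measurable_sup_self_norm ipP sepH filtF adX adeps rho0).
(* [C] may exceed [Cn]: the first bound takes it positive and decreasing to [Cn]. *)
have tail lam r C : 0 <= lam -> lam * B < 1 -> 0 < r -> Cn <= C ->
    (P [set w | (r <= sup w)%R] <=
     (2 * expR (- (lam * r) + bernstein_rate B lam * C ^+ 2))%:E)%E.
  move=> lam0 lamB r0 CC.
  apply: (tail_bound ipP sepH filtF adX adeps cent B0 adsigma mom rho0) => //.
  move: sumC; apply: filterS => w /le_trans; apply.
  by rewrite ler_pXn2r// nnegrE (le_trans Cn0).
have mge r : measurable [set w | r <= sup w].
  rewrite [X in measurable X](_ : _ = setT `&` sup @^-1` `[r, +oo[); first exact: msup.
  by rewrite setTI; apply/seteqP; split => w /=; rewrite in_itv/= andbT.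
split=> [delta /andP[del0 del1]|r r0].
  pose L := ln (2 / delta); pose s := Num.sqrt (2 * L).
  have L0 : 0 < L by rewrite ln_gt0// ltr_pdivlMr// mul1r (lt_trans del1)// ltr1n.
  have s0 : 0 < s by rewrite sqrtr_gt0 mulr_gt0.
  have s2 : L = s ^+ 2 / 2 by rewrite sqr_sqrtr ?mulr_ge0 1?ltW// mulrC mulKf.
  have eL : 2 * expR (- L) = delta.
    by rewrite expRN lnK ?posrE ?divr_gt0// invf_div mulrC divfK.
  pose thr := B * L + Cn * s.
  (* These events increase to [thr < sup], the complement of the target event; the tail bound only
     controls non-strict excess. *)
  pose Ev k := [set w | thr + s / k.+1%:R <= sup w].
  have Evle k : (P (Ev k) <= delta%:E)%E.
    pose C := Cn + k.+1%:R^-1.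
    have C0 : 0 < C by rewrite ltr_wpDl.
    have CB0 : 0 < C + B * s by rewrite ltr_pwDl// mulr_ge0// ltW.
    have thrE : thr + s / k.+1%:R = B * L + C * s.
      by rewrite /thr /C mulrDl -addrA (mulrC s).
    rewrite /Ev thrE -eL.
    have := tail (s / (C + B * s)) (B * L + C * s) C.
    (* Here [1 - lam B = C / (C + B s)], so the exponent is exactly [- s^2 / 2 = - L]; [C > 0] keeps
       it meaningful even for [Cn = 0]. *)
    have -> : - (s / (C + B * s) * (B * L + C * s)) +
        bernstein_rate B (s / (C + B * s)) * C ^+ 2 = - L.
      rewrite /bernstein_rate s2; field.
      by rewrite (gt_eqF CB0)/= (mulrC s) addrK gt_eqF.
    apply.
    - by rewrite divr_ge0 ?ltW.
    - by rewrite mulrAC ltr_pdivrMr// mul1r (mulrC s) ltr_pwDl.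
    - by rewrite ltr_wpDl ?mulr_gt0// mulr_ge0// ltW.
    - by rewrite lerDl invr_ge0.
  have ndEv : nondecreasing_seq Ev.
    apply/nondecreasing_seqP => k; apply/subsetPset => w /=; apply: le_trans.
    by rewrite lerD2l ler_pM2l// lef_pV2 ?posrE// ler_nat.
  have mEv k : measurable (Ev k) by exact: mge.
  have Ule : (P (\bigcup_k Ev k) <= delta%:E)%E.
    have cvgP : (P \o Ev) k @[k --> \oo] --> P (\bigcup_k Ev k).
      by apply: nondecreasing_cvg_mu => //; exact: bigcup_measurable.
    by apply: (cvge_to_le cvgP); exact: nearW.
  have -> : [set w | sup w <= thr] = ~` (\bigcup_k Ev k).
    apply/seteqP; split => w /=.
      move=> wthr [k _ /= kw]; have := le_trans kw wthr.
      by rewrite gerDl leNgt divr_gt0.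
    move=> nU; rewrite leNgt; apply/negP => thrw; apply: nU.
    have [k kP] : exists k : nat, s / (sup w - thr) < k.+1%:R.
      by exists (Num.truncn (s / (sup w - thr))); exact: truncnS_gt.
    exists k => //; rewrite /Ev/= addrC -lerBrDr ler_pdivrMr// mulrC.
    by rewrite -ler_pdivrMr ?subr_gt0// ltW.
  rewrite probability_setC; last exact: bigcup_measurable.
  rewrite EFinB leeB//.
have le2 : (P [set w | (r <= sup w)%R] <= 2%:E)%E.
  by rewrite (le_trans (probability_le1 P (mge r)))// lee_fin ler1n.
(* For [r = 0] the right-hand side is [2]. *)
move: r0; rewrite le_eqVlt => /predU1P[rE|r0].
  rewrite -rE in le2 *.
  by rewrite expr0n/= mul0r oppr0 expR0 mulr1.
(* For [Cn = 0] the general choice would give [lam B = 1]; [lam = 1 / (2 B)] already yields the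
   exponent [- r / (2 B)]. If moreover [B = 0], division by zero returns [0] and the bound is
   [2]. *)
move: Cn0; rewrite le_eqVlt => /predU1P[C0|Cpos].
  rewrite -C0 expr0n/= add0r; move: B0; rewrite le_eqVlt => /predU1P[<-|Bpos].
    by rewrite mul0r mulr0 invr0 mulr0 oppr0 expR0 mulr1.
  have := tail (2 * B)^-1 r Cn; rewrite -C0 expr0n/= mulr0 addr0.
  have -> : (2 * B)^-1 * r = r ^+ 2 / (2 * (B * r)) by field; rewrite !gt_eqF.
  apply => //; first by rewrite invr_ge0 mulr_ge0// ltW.
  by rewrite invfM mulrVK ?unitfE ?gt_eqF// invf_lt1// ltr1n.
have Q0 : 0 < Cn ^+ 2 + B * r by rewrite ltr_pwDl ?exprn_gt0// mulr_ge0// ltW.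
have := tail (r / (Cn ^+ 2 + B * r)) r Cn.
(* Here [1 - lam B = Cn^2 / (Cn^2 + B r)], so the second summand is half of [lam r]. *)
have -> : - (r / (Cn ^+ 2 + B * r) * r) +
    bernstein_rate B (r / (Cn ^+ 2 + B * r)) * Cn ^+ 2 =
    - (r ^+ 2 / (2 * (Cn ^+ 2 + B * r))).
  rewrite /bernstein_rate; field.
  by rewrite (gt_eqF Q0)/= (mulrC r) addrK sqrf_eq0 gt_eqF.
apply => //; first by rewrite divr_ge0// ltW.
by rewrite mulrAC ltr_pdivrMr// mul1r (mulrC r) ltrDr exprn_gt0.
Qed.
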